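(* Let $(M,L)$ be a Finsler manifold admitting a concurrent $\pi$-vector field $\overline{\zeta}$, and let $(M,\widetilde{L})$ be the Finsler manifold obtained from it by the energy $\beta$-change $\widetilde{L}^{2}=L^{2}+B^{2}$, where $B:=g(\overline{\zeta},\overline{\eta})$. Put $p^{2}:=g(\overline{\zeta},\overline{\zeta})$. Then the curvature tensors of the associated Berwald connections $D^{\circ}$ and $\widetilde{D^{\circ}}$ are related, for all vector fields $X,Y$ on $\mathcal{T}M$ and all $\overline{Z}\in\mathfrak{X}(\pi(M))$, by $$\widetilde{\mathbf{K}^{\circ}}(X,Y)\overline{Z}=\mathbf{K}^{\circ}(X,Y)\overline{Z}+\frac{g(\mathbf{T}(X,Y),\overline{Z})}{1+p^2}\,\overline{\zeta}+H^{\circ}(X,Y)\overline{Z},$$ where $$H^{\circ}(X,Y)\overline{Z}=\mathfrak{U}_{X,Y}\left\{\frac{g(\rho X,\overline{Z})}{1+p^2}\,\rho Y-\frac{g(\rho X,T(KY,\overline{Z}))}{1+p^2}\,\overline{\zeta}+\frac{g(\rho Y,\overline{Z})\,g(\rho X,\overline{\zeta})}{(1+p^2)^2}\,\overline{\zeta}\right\}.$$ In particular, for all $\overline{X},\overline{Y},\overline{Z}\in\mathfrak{X}(\pi(M))$: (a) $\widetilde{S^{\circ}}(\overline{X},\overline{Y})\overline{Z}=S^{\circ}(\overline{X},\overline{Y})\overline{Z}=0$; (b) $\widetilde{P^{\circ}}(\overline{X},\overline{Y})\overline{Z}=P^{\circ}(\overline{X},\overline{Y})\overline{Z}-2\,\dfrac{g(T(\overline{Y},\overline{X}),\overline{Z})}{1+p^2}\,\overline{\zeta}$;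 (c) $\widetilde{R^{\circ}}(\overline{X},\overline{Y})\overline{Z}=R^{\circ}(\overline{X},\overline{Y})\overline{Z}+\mathfrak{U}_{\overline{X},\overline{Y}}\left\{\dfrac{g(\overline{X},\overline{Z})}{1+p^2}\,\overline{Y}+\dfrac{g(\overline{Y},\overline{Z})\,g(\overline{X},\overline{\zeta})}{(1+p^2)^2}\,\overline{\zeta}\right\}$.
   Context: $M$ is a real paracompact smooth manifold of finite dimension $n$; all objects are $C^\infty$. $\pi:\mathcal{T}M\to M$ is the bundle of nonzero tangent vectors, $\pi^{-1}(TM)\to\mathcal{T}M$ the pullback of $TM$ by $\pi$. Sections of $\pi^{-1}(TM)$ are called $\pi$-vector fields, are written with bars, and form the module $\mathfrak{X}(\pi(M))$. The fundamental $\pi$-vector field is $\overline{\eta}(u)=(u,u)$. $\rho:T(\mathcal{T}M)\to\pi^{-1}(TM)$ is $\rho=(\pi_{\mathcal{T}M},d\pi)$, and $\gamma:\pi^{-1}(TM)\to T(\mathcal{T}M)$ is the vertical lift $\gamma(u,v)=j_u(v)$, with $j_u:T_{\pi(u)}M\to T_u(T_{\pi(u)}M)$ the natural isomorphism. $(M,L)$ is a Finsler manifold with Finsler metric $g$ on $\pi^{-1}(TM)$ (locally $g_{ij}=\frac12\partial^2L^2/\partial y^i\partial y^j$). For a linear connection $D$ on $\pi^{-1}(TM)$ its connection map is $K(X)=D_X\overline{\eta}$; $D$ is regular if $T_u(\mathcal{T}M)=V_u(\mathcal{T}M)\oplus\ker K_u$ for all $u$ ($V$ the vertical bundle), and then its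 horizontal map is $\beta:=(\rho|_{\ker K})^{-1}$. The torsion is $\mathbf{T}(X,Y)=D_X\rho Y-D_Y\rho X-\rho[X,Y]$, with $Q(\overline{X},\overline{Y})=\mathbf{T}(\beta\overline{X},\beta\overline{Y})$ and $(h)hv$-torsion $T(\overline{X},\overline{Y})=\mathbf{T}(\gamma\overline{X},\beta\overline{Y})$. The curvature is $\mathbf{K}(X,Y)\rho Z=-D_XD_Y\rho Z+D_YD_X\rho Z+D_{[X,Y]}\rho Z$, with $h$-, $hv$-, $v$-curvatures $R(\overline{X},\overline{Y})\overline{Z}=\mathbf{K}(\beta\overline{X},\beta\overline{Y})\overline{Z}$, $P(\overline{X},\overline{Y})\overline{Z}=\mathbf{K}(\beta\overline{X},\gamma\overline{Y})\overline{Z}$, $S(\overline{X},\overline{Y})\overline{Z}=\mathbf{K}(\gamma\overline{X},\gamma\overline{Y})\overline{Z}$, and $\widehat{P}(\overline{X},\overline{Y})=P(\overline{X},\overline{Y})\overline{\eta}$. The Cartan connection $\nabla$ is the unique regular connection on $\pi^{-1}(TM)$ with $\nabla g=0$, $Q=0$ and $g(T(\overline{X},\overline{Y}),\overline{Z})=g(T(\overline{X},\overline{Z}),\overline{Y})$. A $\pi$-vector field $\overline{\zeta}$ is concurrent if $\nabla_{\beta\overline{X}}\overline{\zeta}=-\overline{X}$ and $\nabla_{\gamma\overline{X}}\overline{\zeta}=0$ for all $\overline{X}$. The Berwald connection of $(M,L)$ is $D^{\circ}_X\overline{Y}=\nabla_X\overline{Y}+\widehat{P}(\rho X,\overline{Y})-T(KX,\overline{Y})$,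 with $\widehat{P},T,K$ those of $\nabla$; it has the same connection map and horizontal map as $\nabla$. Its curvature and $h$-, $hv$-, $v$-curvature tensors are $\mathbf{K}^{\circ},R^{\circ},P^{\circ},S^{\circ}$. The undecorated $\mathbf{T},T,K,\beta$ are those of the Cartan connection $\nabla$ of $L$. Tilded objects are those of $\widetilde{L}$ (defined with its own horizontal map). $\mathfrak{U}_{X,Y}\{A(X,Y)\}:=A(X,Y)-A(Y,X)$. *)

(* Defs.v *)
From HB Require Import structures.
From mathcomp Require Import all_boot all_order all_algebra.
From mathcomp Require Import all_classical all_reals topology normedtype landau derive.
From mathcomp Require Import ring lra.

Set Implicit Arguments.
Unset Strict Implicit.
Unset Printing Implicit Defensive.

Import Order.TTheory GRing.Theory Num.Theory numFieldNormedType.Exports.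

Local Open Scope classical_set_scope.
Local Open Scope ring_scope.

Section Smooth.
Context {R : realType} {m : nat}.
Implicit Types (A : set 'rV[R]_m) (f g : 'rV[R]_m -> R).

(* The domain [A] is meant to be open; in finite dimension this is the usual
   class C^k. *)
Fixpoint Ck (k : nat) A f : Prop :=
  if k is k'.+1 then
    (forall x, A x -> differentiable f x) /\ (forall v, Ck k' A ('D_v f))
  else forall x, A x -> {for x, continuous f}.

Definition smooth A f := forall k, Ck k A f.

Definition smooth_at (x : 'rV[R]_m) f := exists A, [/\ open A, A x & smooth A f].

Lemma CkS k A f : Ck k.+1 A f -> Ck k A f.
Proof.
elim: k f => [|k IH] f; first by case=> df _ x /df /differentiable_continuous.
by case=> df Df; split=> // v; apply: IH; exact: Df.
Qed.

Lemma Ck_sub k A B f : B `<=` A -> Ck k A f -> Ck k B f.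
Proof.
move=> BA; elim: k f => [|k IH] f /=; first by move=> fc x /BA /fc.
by case=> df Df; split=> [x /BA /df//|v]; exact/IH/Df.
Qed.

Lemma smooth_sub A B f : B `<=` A -> smooth A f -> smooth B f.
Proof. by move=> BA fs k; exact: Ck_sub (fs k). Qed.

Lemma smooth_diff A f x : smooth A f -> A x -> differentiable f x.
Proof. by move=> /(_ 1%N)[+ _]; apply. Qed.

Lemma smooth_derive A f v : smooth A f -> smooth A ('D_v f).
Proof. by move=> fs k; have [_] := fs k.+1; exact. Qed.

Lemma open_near A (P : 'rV[R]_m -> Prop) x :
  open A -> A x -> (forall y, A y -> P y) -> \forall y \near x, P y.
Proof.
move=> oA Ax AP; have := open_nbhs_nbhs (conj oA Ax).
by apply: filterS => y; exact: AP.
Qed.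


Lemma near_eq_differentiable f g x :
  (\forall y \near x, f y = g y) -> differentiable f x -> differentiable g x.
Proof.
move=> fg df.
pose h : 'rV[R]_m -> R := g - f.
have -> : g = f + h by rewrite addrC subrK.
apply: differentiableD => //.
have h0 : \forall y \near x, h y = 0.
  by apply: filterS fg => y fgy; rewrite /h !fctE fgy subrr.
have hloc : h \o shift x = cst (h x) + (\0 : 'rV[R]_m -> R) +o_ (0 : 'rV[R]_m) id.
  apply/eqaddoP => e e0.
  move: h0; rewrite (near_shift 0 x) => h0; near=> y.
  have hy : h (y + x) = 0 by rewrite -[x]subr0; near: y; exact: h0.
  have hx : h x = 0 by move: (nbhs_singleton h0); rewrite /= add0r subr0.
  rewrite !fctE /= hy hx !addr0 subr0 normr0; exact: mulr_ge0 (ltW e0) _.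
have dh := @diff_unique _ _ _ h \0 x (@cst_continuous _ _ 0) hloc.
by apply/diff_locallyP; rewrite dh; split => //; exact: cst_continuous.
Unshelve. all: by end_near. Qed.


Lemma Ck_ext k A f g : open A -> (forall x, A x -> f x = g x) ->
  Ck k A f -> Ck k A g.
Proof.
move=> oA; elim: k f g => [|k IH] f g fg /=.
  move=> fc x Ax; change (g @ x --> g x); rewrite -fg//.
  have n : \forall y \near x, f y = g y by exact: (open_near oA Ax).
  exact: cvg_trans (@near_eq_cvg _ _ (nbhs x) _ _ _ n) (fc x Ax).
case=> df Df; split=> [x Ax|v].
  by apply: near_eq_differentiable (df x Ax); exact: open_near oA Ax _.
apply: IH (Df v) => x Ax; apply: near_eq_derive.
have n : \forall y \near x, f y = g y by exact: (open_near oA Ax).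
by apply: filterS n.
Unshelve. all: by end_near. Qed.

Lemma smooth_ext A f g : open A -> (forall x, A x -> f x = g x) ->
  smooth A f -> smooth A g.
Proof. by move=> oA fg fs k; exact: Ck_ext (fs k). Qed.

Lemma Ck_cst k A (c : R) : Ck k A (fun=> c).
Proof.
elim: k c => [|k IH] c /=; first by move=> x _; exact: cst_continuous.
split=> [x _|v]; first exact: differentiable_cst.
rewrite (_ : 'D_v _ = fun=> 0); first exact: IH.
by apply/funext => x; exact: derive_cst.
Qed.

Lemma smooth_cst A (c : R) : smooth A (fun=> c).
Proof. by move=> k; exact: Ck_cst. Qed.

Lemma CkD k A f g : open A -> Ck k A f -> Ck k A g ->
  Ck k A (fun x => f x + g x).
Proof.
move=> oA; elim: k f g => [|k IH] f g /=.
  by move=> fc gc x Ax; exact: (continuousD (fc x Ax) (gc x Ax)).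
move=> [df Df] [dg Dg]; split=> [x Ax|v].
  exact: (differentiableD (df x Ax) (dg x Ax)).
apply: Ck_ext (IH _ _ (Df v) (Dg v)) => // x Ax.
by rewrite deriveD//; apply: diff_derivable; [exact: df|exact: dg].
Qed.

Lemma smoothD A f g : open A -> smooth A f -> smooth A g ->
  smooth A (fun x => f x + g x).
Proof. by move=> oA fs gs k; exact: CkD. Qed.

Lemma CkM k A f g : open A -> Ck k A f -> Ck k A g ->
  Ck k A (fun x => f x * g x).
Proof.
move=> oA; elim: k f g => [|k IH] f g.
  by move=> fc gc x Ax; exact: (continuousM (fc x Ax) (gc x Ax)).
move=> Cf Cg; have [fk gk] := (CkS Cf, CkS Cg).
case: Cf Cg => df Df [dg Dg]; split=> [x Ax|v].
  exact: (differentiableM (df x Ax) (dg x Ax)).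
apply: Ck_ext (CkD oA (IH _ _ fk (Dg v)) (IH _ _ gk (Df v))) => // x Ax.
by rewrite deriveM//; apply: diff_derivable; [exact: df|exact: dg].
Qed.

Lemma smoothM A f g : open A -> smooth A f -> smooth A g ->
  smooth A (fun x => f x * g x).
Proof. by move=> oA fs gs k; exact: CkM. Qed.

Lemma smoothN A f : open A -> smooth A f -> smooth A (fun x => - f x).
Proof.
move=> oA fs; apply: smooth_ext (smoothM oA (smooth_cst A (-1)) fs) => // x _.
by rewrite mulN1r.
Qed.

Lemma smooth_sum (I : Type) (r : seq I) A (f : I -> 'rV[R]_m -> R) :
  open A -> (forall i, smooth A (f i)) ->
  smooth A (fun x => \sum_(i <- r) f i x).
Proof.
move=> oA fs; elim: r => [|i r IH].
  apply: smooth_ext (smooth_cst A 0) => // x _; by rewrite big_nil.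
apply: smooth_ext (smoothD oA (fs i) IH) => // x _; by rewrite big_cons.
Qed.

Lemma smooth_coord A j : smooth A (fun x => x 0 j).
Proof.
case=> [|k] /=; first by move=> x _; exact: coord_continuous.
split=> [x _|v]; first exact: differentiable_coord.
rewrite (_ : 'D_v _ = fun=> v 0 j); first exact: Ck_cst.
apply/funext => x; have := derive_id x v.
by rewrite derive_mx; [move/matrixP/(_ 0 j); rewrite mxE|exact: derivable_id].
Qed.

Lemma derive_sum_delta f x (v : 'rV[R]_m) : differentiable f x ->
  'D_v f x = \sum_j v 0 j * 'D_(delta_mx 0 j) f x.
Proof.
move=> df; rewrite deriveE// {1}(row_sum_delta v) linear_sum.
by apply: eq_bigr => j _; rewrite linearZ deriveE.
Qed.

Lemma deriveZ_dir f x (a : R) (v : 'rV[R]_m) : differentiable f x ->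
  'D_(a *: v) f x = a * 'D_v f x.
Proof. by move=> df; rewrite !deriveE// linearZ. Qed.

Lemma deriveD_dir f x (v w : 'rV[R]_m) : differentiable f x ->
  'D_(v + w) f x = 'D_v f x + 'D_w f x.
Proof. by move=> df; rewrite !deriveE// linearD. Qed.

End Smooth.

Definition smooth_map {R : realType} {m p : nat} (A : set 'rV[R]_m)
  (F : 'rV[R]_m -> 'rV[R]_p) := forall j, smooth A (fun x => F x 0 j).

Section SmoothMap.
Context {R : realType}.

Lemma smooth_map_sub {m p} (A B : set 'rV[R]_m) (F : 'rV[R]_m -> 'rV[R]_p) :
  B `<=` A -> smooth_map A F -> smooth_map B F.
Proof. by move=> BA Fs j; exact: smooth_sub (Fs j). Qed.

Lemma smooth_map_ext {m p} (A : set 'rV[R]_m) (F G : 'rV[R]_m -> 'rV[R]_p) :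
  open A -> (forall x, A x -> F x = G x) -> smooth_map A F -> smooth_map A G.
Proof.
by move=> oA FG Fs j; apply: smooth_ext (Fs j) => // x Ax; rewrite FG.
Qed.

Lemma differentiable_row {m p} (F : 'rV[R]_m -> 'rV[R]_p) x :
  (forall j, differentiable (fun x => F x 0 j) x) -> differentiable F x.
Proof.
move=> dF; have -> : F = \sum_(j < p) (fun x => F x 0 j *: delta_mx 0 j).
  by apply/funext => y; rewrite fct_sumE [LHS]row_sum_delta.
by apply: differentiable_sum => j; exact: differentiableZl.
Qed.

Lemma smooth_map_diff {m p} (A : set 'rV[R]_m) (F : 'rV[R]_m -> 'rV[R]_p) x :
  smooth_map A F -> A x -> differentiable F x.
Proof. by move=> Fs Ax; apply: differentiable_row => j; exact: smooth_diff (Fs j) Ax. Qed.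

Lemma derive_coord {m p} (F : 'rV[R]_m -> 'rV[R]_p) x v j :
  differentiable F x -> ('D_v F x) 0 j = 'D_v (fun x => F x 0 j) x.
Proof. by move=> dF; rewrite derive_mx ?mxE//; exact: diff_derivable. Qed.

Lemma derive_comp {m p} (F : 'rV[R]_m -> 'rV[R]_p) (g : 'rV[R]_p -> R) x v :
  differentiable F x -> differentiable g (F x) ->
  'D_v (g \o F) x = 'D_('D_v F x) g (F x).
Proof.
move=> dF dg; rewrite !deriveE//; last exact: differentiable_comp.
by rewrite diff_comp.
Qed.

Lemma smooth_comp {m p} (A : set 'rV[R]_m) (B : set 'rV[R]_p)
    (F : 'rV[R]_m -> 'rV[R]_p) (g : 'rV[R]_p -> R) :
  open A -> (forall x, A x -> B (F x)) ->
  smooth_map A F -> smooth B g -> smooth A (g \o F).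
Proof.
move=> oA AB Fs gs k; elim: k g gs => [|k IH] g gs.
  move=> x Ax; apply: continuous_comp; last exact: (gs 0%N) (AB _ Ax).
  exact/differentiable_continuous/(smooth_map_diff Fs).
split=> [x Ax|v].
  by apply: differentiable_comp; [exact: smooth_map_diff Ax|
    exact: smooth_diff gs (AB _ Ax)].
pose h j := fun x => 'D_v (fun x => F x 0 j) x * ('D_(delta_mx 0 j) g \o F) x.
have hk j : Ck k A (h j).
  by apply: CkM => //; [exact: (smooth_derive v (Fs j))|exact/IH/smooth_derive].
apply: (@Ck_ext _ _ _ _ (fun x => \sum_(j <- index_enum 'I_p) h j x)) => //.
  move=> x Ax; have dF := smooth_map_diff Fs Ax.
  have dg := smooth_diff gs (AB _ Ax).
  rewrite derive_comp// derive_sum_delta//; apply: eq_bigr => j _.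
  by rewrite derive_coord.
elim: (index_enum _) => [|j r IHr].
  by apply: Ck_ext (Ck_cst k A 0) => // x _; rewrite big_nil.
by apply: Ck_ext (CkD oA (hk j) IHr) => // x _; rewrite big_cons.
Qed.

Lemma smooth_derive_along {m} (A : set 'rV[R]_m) (xi : 'rV[R]_m -> 'rV[R]_m) f :
  open A -> smooth_map A xi -> smooth A f -> smooth A (fun x => 'D_(xi x) f x).
Proof.
move=> oA xis fs.
apply: (@smooth_ext _ _ _ (fun x => \sum_j xi x 0 j * 'D_(delta_mx 0 j) f x)) => //.
  by move=> x Ax; rewrite -derive_sum_delta//; exact: smooth_diff Ax.
by apply: smooth_sum => // j; apply: smoothM => //; exact: smooth_derive.
Qed.

Lemma is_derive_line {m} (f : 'rV[R]_m -> R) (x v : 'rV[R]_m) (t : R) :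
  differentiable f (x + t *: v) ->
  is_derive t 1 (fun t => f (x + t *: v)) ('D_v f (x + t *: v)).
Proof.
move=> df.
have dl : is_diff t (fun t : R => x + t *: v) (fun s => s *: v).
  have := @is_diffD _ _ _ _ _ _ _ t (is_diff_cst x t) (is_diff_scalel t v).
  by rewrite add0r.
have dc : differentiable (f \o (fun t : R => x + t *: v)) t.
  by apply: differentiable_comp => //; exact: ex_diff.
apply: DeriveDef; first exact: diff_derivable.
by rewrite [LHS]deriveE// diff_comp//= (deriveE v)//= diff_val scale1r.
Qed.

Lemma derive_line {m} (f : 'rV[R]_m -> R) (x v : 'rV[R]_m) :
  differentiable f x -> 'D_1 (fun t : R => f (x + t *: v)) 0 = 'D_v f x.
Proof.
move=> df; have := @is_derive_line _ f x v 0.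
by rewrite scale0r addr0 => /(_ df)[].
Qed.

End SmoothMap.

Section Schwarz.
Context {R : realType} {m : nat}.
Implicit Types (A : set 'rV[R]_m) (F : 'rV[R]_m -> R).

Lemma mixed_mean A F (e v w : 'rV[R]_m) (h : R) :
  smooth A F -> 0 < h ->
  (forall s t, 0 <= s <= h -> 0 <= t <= h -> A (e + s *: v + t *: w)) ->
  exists s t, [/\ 0 <= s <= h, 0 <= t <= h &
    F (e + h *: v + h *: w) - F (e + h *: w) - F (e + h *: v) + F e =
    h ^+ 2 * 'D_w ('D_v F) (e + s *: v + t *: w)].
Proof.
move=> Fs h0 Ah.
have hh : 0 <= h <= h by rewrite lexx ltW.
have h00 : 0 <= (0 : R) <= h by rewrite le_refl ltW.
pose phi (s : R) := F ((e + h *: w) + s *: v) - F (e + s *: v).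
pose dphi (s : R) := 'D_v F ((e + h *: w) + s *: v) - 'D_v F (e + s *: v).
have dP s : 0 <= s <= h -> is_derive s 1 phi (dphi s).
  move=> sh; apply: is_deriveB; apply: is_derive_line; apply: smooth_diff Fs _.
    by rewrite addrAC; exact: Ah.
  by have := Ah s 0 sh h00; rewrite scale0r addr0.
have [||s /itvP sI phiE] := @MVT R phi dphi 0 h h0.
- by move=> s /itvP sI; apply: dP; rewrite !sI.
- apply: derivable_within_continuous => s /itvP sI.
  have sh : 0 <= s <= h by rewrite !sI.
  by have [] := dP s sh.
have sh : 0 <= s <= h by rewrite !sI.
pose psi (t : R) := 'D_v F ((e + s *: v) + t *: w).
pose dpsi (t : R) := 'D_w ('D_v F) ((e + s *: v) + t *: w).
have dQ t : 0 <= t <= h -> is_derive t 1 psi (dpsi t).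
  move=> th; apply: is_derive_line; apply: (smooth_diff (smooth_derive v Fs)).
  exact: Ah.
have [||t /itvP tI psiE] := @MVT R psi dpsi 0 h h0.
- by move=> t /itvP tI; apply: dQ; rewrite !tI.
- apply: derivable_within_continuous => t /itvP tI.
  have th : 0 <= t <= h by rewrite !tI.
  by have [] := dQ t th.
exists s, t; split; [by []|by rewrite !tI|].
move: phiE psiE; rewrite /phi /dphi /psi /dpsi !scale0r !addr0 !subr0.
rewrite (addrAC e (h *: w) (h *: v)) (addrAC e (h *: w) (s *: v)).
move=> phiE psiE; rewrite psiE in phiE.
rewrite -[RHS]mulrC expr2 mulrA -phiE; ring.
Qed.

Lemma Schwarz A F (e v w : 'rV[R]_m) : open A -> A e -> smooth A F ->
  'D_w ('D_v F) e = 'D_v ('D_w F) e.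
Proof.
move=> oA Ae Fs; apply/eqP; rewrite -subr_eq0 -normr_le0.
apply/ler_addgt0Pr => eps eps0; rewrite add0r.
pose G := 'D_w ('D_v F); pose H := 'D_v ('D_w F).
have cont f : smooth A f -> \forall x \near e, `|f e - f x| < eps / 2.
  move=> fs; have : f x @[x --> e] --> f e := fs 0%N e Ae.
  by move/cvgrPdist_lt; apply; rewrite divr_gt0.
have Gn := cont _ (smooth_derive w (smooth_derive v Fs)).
have Hn := cont _ (smooth_derive v (smooth_derive w Fs)).
have An : \forall x \near e, A x by exact: open_near oA Ae _.
have Nn : nbhs e [set x | A x /\ `|G e - G x| < eps / 2 /\ `|H e - H x| < eps / 2].
  exact: (@filterI _ (nbhs e) _ _ _ An (@filterI _ (nbhs e) _ _ _ Gn Hn)).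
have [r /= r0 rP] := (nbhs_ballP _ _).1 Nn.
pose N := `|v| + `|w| + 1.
have N0 : 0 < N by rewrite ltr_wpDl// addr_ge0.
pose h := r / 2 / N.
have h0 : 0 < h by rewrite !divr_gt0.
have hP s t : 0 <= s <= h -> 0 <= t <= h -> ball e r (e + s *: v + t *: w).
  move=> /andP[s0 sh] /andP[t0 th]; rewrite -ball_normE /=.
  rewrite -addrA opprD addNKr normrN (le_lt_trans (ler_normD _ _))//.
  rewrite !normrZ !ger0_norm//.
  have hN : h * N < r by rewrite /h divfK ?gt_eqF// ltr_pdivrMr// ltr_pMr// ltr1n.
  apply: le_lt_trans hN; rewrite /N !mulrDr mulr1.
  rewrite -[leLHS]addr0 lerD ?(ltW h0)// lerD// ler_wpM2r//.
have Av s t sh th := (rP _ (hP s t sh th)).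
have [s1 [t1 [s1h t1h E1]]] := @mixed_mean A F e v w h Fs h0 (fun s t sh th => proj1 (Av s t sh th)).
have [s2 [t2 [s2h t2h E2]]] : exists s t, [/\ 0 <= s <= h, 0 <= t <= h &
    F (e + h *: w + h *: v) - F (e + h *: v) - F (e + h *: w) + F e =
    h ^+ 2 * 'D_v ('D_w F) (e + s *: w + t *: v)].
  apply: (@mixed_mean A) => // s t sh th; rewrite addrAC.
  by have [] := Av t s th sh.
rewrite (addrAC e (s2 *: w)) in E2.
have [_ [g1 _]] := Av _ _ s1h t1h.
have [_ [_ g2]] := Av _ _ t2h s2h.
have swap (a b c d : R) : a - b - c + d = a - c - b + d by rewrite (addrAC a).
have GH : G (e + s1 *: v + t1 *: w) = H (e + t2 *: v + s2 *: w).
  apply: (mulfI (lt0r_neq0 (exprn_gt0 2 h0))).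
  apply: etrans (esym E1) _; apply: etrans _ E2.
  by rewrite (addrAC e (h *: w)); exact: swap.
change (`|G e - H e| <= eps).
apply: le_trans (ler_distD (G (e + s1 *: v + t1 *: w)) _ _) _.
rewrite (splitr eps); apply: lerD; first exact: ltW g1.
rewrite GH distrC; exact: ltW g2.
Qed.

Lemma derive_derive_along A F (xi : 'rV[R]_m -> 'rV[R]_m) (e w : 'rV[R]_m) :
  open A -> A e -> smooth A F -> smooth_map A xi ->
  'D_w (fun x => 'D_(xi x) F x) e = 'D_('D_w xi e) F e + 'D_(xi e) ('D_w F) e.
Proof.
move=> oA Ae Fs xis.
pose f := \sum_j (fun x => xi x 0 j * 'D_(delta_mx 0 j) F x).
have dx j : derivable (fun x => xi x 0 j) e w.
  exact/diff_derivable/(smooth_diff (xis j) Ae).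
have dd j : derivable ('D_(delta_mx 0 j) F) e w.
  exact/diff_derivable/(smooth_diff (smooth_derive _ Fs) Ae).
have -> : 'D_w (fun x => 'D_(xi x) F x) e = 'D_w f e.
  apply: near_eq_derive.
  have n : \forall x \near e, A x by exact: open_near oA Ae _.
  apply: filterS n => x Ax; rewrite /f fct_sumE.
  exact: derive_sum_delta (smooth_diff Fs Ax).
rewrite /f derive_sum => [|j]; last exact: derivableM.
rewrite (derive_sum_delta ('D_w xi e)); last exact: smooth_diff Fs Ae.
rewrite (derive_sum_delta (xi e)); last exact: smooth_diff (smooth_derive _ Fs) Ae.
rewrite -big_split; apply: eq_bigr => j _ /=.
rewrite (deriveM (dx j) (dd j)) derive_coord; last exact: smooth_map_diff xis Ae.
rewrite (Schwarz (delta_mx 0 j) w oA Ae Fs).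
by rewrite addrC; congr (_ + _); exact: mulrC.
Qed.

Lemma derive_bracket A F (xi up : 'rV[R]_m -> 'rV[R]_m) (e : 'rV[R]_m) :
  open A -> A e -> smooth A F -> smooth_map A xi -> smooth_map A up ->
  'D_(xi e) (fun x => 'D_(up x) F x) e - 'D_(up e) (fun x => 'D_(xi x) F x) e =
  'D_('D_(xi e) up e - 'D_(up e) xi e) F e.
Proof.
move=> oA Ae Fs xis ups; rewrite (derive_derive_along _ oA Ae Fs ups) (derive_derive_along _ oA Ae Fs xis).
have dF := smooth_diff Fs Ae.
rewrite (deriveD_dir _ _ dF) -[- ('D_(up e) xi e)]scaleN1r (deriveZ_dir _ _ dF) mulN1r.
have swap (a b c d : R) : b = d -> a + b - (c + d) = a - c.
  by move=> ->; rewrite opprD addrACA subrr addr0.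
exact/swap/(Schwarz (xi e) (up e) oA Ae Fs).
Qed.

End Schwarz.

Section OpenPreimage.
Context {R : realType} {m p : nat}.

Lemma open_preimage (A : set 'rV[R]_m) (B : set 'rV[R]_p)
    (T : 'rV[R]_m -> 'rV[R]_p) :
  open A -> open B -> smooth_map A T -> open (A `&` T @^-1` B).
Proof.
move=> oA oB Ts; rewrite openE => x [Ax BTx].
apply: (@filterI _ (nbhs x)); first exact: open_nbhs_nbhs.
have Tc : {for x, continuous T}.
  exact/differentiable_continuous/(smooth_map_diff Ts Ax).
by apply: Tc; exact: open_nbhs_nbhs.
Qed.

End OpenPreimage.

(* A family of local parametrisations of [point] by open subsets of R^m, each a
   partial map; [par_compat] says that, near any pair of parameters of a common
   point, two of them differ by a smooth change of parameters.  This carries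
   the smooth structure only; the topology of the base manifold is part of
   [manifold] below.  It is used both for M and for its slit tangent bundle. *)
Record atlas (R : realType) (m : nat) := Atlas {
  point :> Type;
  index : Type;
  par : index -> 'rV[R]_m -> option point;
  par_open : forall i, open [set e | isSome (par i e)];
  par_cover : forall p, exists i e, par i e = Some p;
  par_compat : forall i j e e' p, par i e = Some p -> par j e' = Some p ->
    exists A (T : 'rV[R]_m -> 'rV[R]_m),
      [/\ open A, A e, T e = e', smooth_map A T &
          forall x, A x -> par j (T x) = par i x] }.

Arguments par {R m} _ _ _.

Section Atlas.
Context {R : realType} {m : nat} (N : atlas R m).
Implicit Types (i j : index N) (p q : N) (f : N -> R).

Definition dom i : set 'rV[R]_m := [set e | isSome (par N i e)].

(* [f] read in the parametrisation [i]; the value 0 outside the domain is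
   irrelevant, since the domain is open. *)
Definition pull i f : 'rV[R]_m -> R := fun e => oapp f 0 (par N i e).

(* [f] is smooth in a neighbourhood of [p]. *)
Definition smooth_germ p f :=
  forall i e, par N i e = Some p -> smooth_at e (pull i f).

Definition smooth_fun f := forall p, smooth_germ p f.

Lemma pullE i e p f : par N i e = Some p -> pull i f e = f p.
Proof. by rewrite /pull => ->. Qed.

Lemma domP i e : dom i e -> exists p, par N i e = Some p.
Proof. by rewrite /dom /=; case: (par N i e) => // p _; exists p. Qed.

Lemma domS i e p : par N i e = Some p -> dom i e.
Proof. by rewrite /dom /= => ->. Qed.

Lemma open_dom i : open (dom i).
Proof. exact: par_open. Qed.

Lemma smooth_germ_chart i e p f :
  par N i e = Some p -> smooth_at e (pull i f) -> smooth_germ p f.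
Proof.
move=> ie [B [oB Be fs]] j e' je'.
have [A [T [oA Ae' Te' Ts TP]]] := par_compat je' ie.
have oC := open_preimage oA oB Ts.
exists (A `&` T @^-1` B); split=> //; first by split=> //=; rewrite Te'.
apply: smooth_ext (smooth_comp oC _ (smooth_map_sub (@subIsetl _ _ _) Ts) fs) => //.
  by move=> x [Ax _]; rewrite /= /pull TP.
by move=> x [].
Qed.

Lemma smooth_germ_open i e p f : par N i e = Some p -> smooth_germ p f ->
  exists A, [/\ open A, A e, A `<=` dom i, smooth A (pull i f) &
    forall e' q, A e' -> par N i e' = Some q -> smooth_germ q f].
Proof.
move=> ie /(_ _ _ ie)[B [oB Be fs]].
have oA : open (B `&` dom i) by apply: openI => //; exact: open_dom.
have fsA := smooth_sub (@subIsetl _ B (dom i)) fs.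
exists (B `&` dom i); split => //; first by split => //; exact: domS ie.
by move=> e' q Ae' ie'; apply: smooth_germ_chart ie' _; exists (B `&` dom i).
Qed.

(* A tangent vector at [p] is a functional on germs which, in every local
   parametrisation, is a directional derivative \sum_k b_k d/dx^k.  Functionals
   are defined on all functions, so the value on functions that are not smooth
   near [p] is fixed to 0; with this convention equality of tangent vectors is
   equality on smooth germs ([tangentP]). *)
Definition is_tangent p : {pred (N -> R) -> R} := fun v => `[< forall i e,
  par N i e = Some p -> exists b, forall f,
    v f = if `[< smooth_germ p f >] then 'D_b (pull i f) e else 0 >].

Lemma smooth_germ_diff i e p f : par N i e = Some p -> smooth_germ p f ->
  differentiable (pull i f) e.
Proof. by move=> ie /(_ _ _ ie)[A [_ Ae fs]]; exact: smooth_diff fs Ae. Qed.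

Lemma is_tangent_submod p : submod_closed (is_tangent p).
Proof.
split=> [|a v w /asboolP vt /asboolP wt].
  apply/asboolP => i e ie; exists 0 => f; rewrite derive0.
  by case: ifP.
apply/asboolP => i e ie; have [[b bP] [c cP]] := (vt _ _ ie, wt _ _ ie).
exists (a *: b + c) => f; rewrite -[LHS]/(a * v f + w f) bP cP.
case: asboolP => [fs|_]; last by rewrite mulr0 addr0.
have df := smooth_germ_diff ie fs.
by rewrite (deriveD_dir _ _ df) (deriveZ_dir _ _ df).
Qed.

HB.instance Definition _ p :=
  GRing.isSubmodClosed.Build R _ (is_tangent p) (is_tangent_submod p).

Record tangent p := Tangent {
  tval :> (N -> R) -> R;
  tvalP : tval \in is_tangent p }.

HB.instance Definition _ p := [isSub for @tval p].
HB.instance Definition _ p := [Choice of tangent p by <:].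
HB.instance Definition _ p := [SubChoice_isSubLmodule of tangent p by <:].

Definition dir p i e b : (N -> R) -> R :=
  fun f => if `[< smooth_germ p f >] then 'D_b (pull i f) e else 0.

Lemma dir_tangent p i e b : par N i e = Some p -> dir p i e b \in is_tangent p.
Proof.
move=> ie; apply/asboolP => j e' je'.
have [A [T [oA Ae Te Ts TP]]] := par_compat ie je'.
exists ('D_b T e) => f; rewrite /dir; case: asboolP => // fs.
have df := smooth_germ_diff je' fs; subst e'.
rewrite -(derive_comp b (smooth_map_diff Ts Ae) df).
apply: near_eq_derive; have n : \forall x \near e, A x by exact: open_near oA Ae _.
by apply: filterS n => x Ax; rewrite /= /pull TP.
Qed.

(* [v = \sum_k b_k d/dx^k] in the parametrisation [i] at the parameter [e]. *)
Definition is_comp i e p b (v : tangent p) :=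
  forall f, smooth_germ p f -> v f = 'D_b (pull i f) e.

(* The components are smooth in every parametrisation. *)
Definition smooth_vf (X : forall p, tangent p) := forall i,
  exists2 xi : 'rV[R]_m -> 'rV[R]_m, smooth_map (dom i) xi &
    forall e p, par N i e = Some p -> is_comp i e (xi e) (X p).

Record vfield := VField {
  vf :> forall p, tangent p;
  vfP : smooth_vf vf }.

Lemma vfieldP (X Y : vfield) : (forall p, X p = Y p) -> X = Y.
Proof.
case: X Y => X Xs [Y Ys] /= XY.
have {}XY : X = Y by apply: functional_extensionality_dep.
by subst Y; congr VField; exact: Prop_irrelevance.
Qed.

Lemma tangentP p (v w : tangent p) :
  (forall f, smooth_germ p f -> v f = w f) -> v = w.
Proof.
move=> vw; apply/val_inj/funext => f /=.
have [fs|nfs] := pselect (smooth_germ p f); first exact: vw.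
have [i [e ie]] := par_cover p.
have /asboolP/(_ _ _ ie)[b ->] := tvalP v.
have /asboolP/(_ _ _ ie)[c ->] := tvalP w.
by rewrite (asboolF nfs).
Qed.

(* [X, Y]_p f = X_p (Y f) - Y_p (X f). *)
Definition bracket_val (X Y : vfield) p : (N -> R) -> R := fun f =>
  if `[< smooth_germ p f >] then X p (Y ^~ f) - Y p (X ^~ f) else 0.

Lemma smooth_vf_germ (X : vfield) p f : smooth_germ p f -> smooth_germ p (X ^~ f).
Proof.
move=> fs; have [i [e ie]] := par_cover p.
have [xi xis xiP] := vfP X i.
have [A [oA Ae Ad fA nA]] := smooth_germ_open ie fs.
apply: smooth_germ_chart ie _; exists A; split=> //.
apply: smooth_ext (smooth_derive_along oA (smooth_map_sub Ad xis) fA) => // x Ax.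
have [q iq] := domP (Ad _ Ax).
by rewrite (pullE _ iq) (xiP _ _ iq)//; exact: nA iq.
Qed.

Lemma bracket_comp (X Y : vfield) i (xi up : 'rV[R]_m -> 'rV[R]_m) e p f :
  smooth_map (dom i) xi -> smooth_map (dom i) up ->
  (forall e p, par N i e = Some p -> is_comp i e (xi e) (X p)) ->
  (forall e p, par N i e = Some p -> is_comp i e (up e) (Y p)) ->
  par N i e = Some p -> smooth_germ p f ->
  X p (Y ^~ f) - Y p (X ^~ f) = 'D_('D_(xi e) up e - 'D_(up e) xi e) (pull i f) e.
Proof.
move=> xis ups xiP upP ie fs.
have [A [oA Ae Ad fA nA]] := smooth_germ_open ie fs.
have pE (Z : vfield) (zt : 'rV[R]_m -> 'rV[R]_m) b :
    (forall e p, par N i e = Some p -> is_comp i e (zt e) (Z p)) ->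
    'D_b (pull i (Z ^~ f)) e = 'D_b (fun x => 'D_(zt x) (pull i f) x) e.
  move=> ztP; apply: near_eq_derive.
  have n : \forall x \near e, A x by exact: open_near oA Ae _.
  apply: filterS n => x Ax; have [q iq] := domP (Ad _ Ax).
  by rewrite (pullE _ iq) (ztP _ _ iq)//; exact: nA iq.
rewrite (xiP _ _ ie _ (smooth_vf_germ Y fs)) (upP _ _ ie _ (smooth_vf_germ X fs)).
rewrite (pE Y up)// (pE X xi)//.
exact: derive_bracket oA Ae fA (smooth_map_sub Ad xis) (smooth_map_sub Ad ups).
Qed.

Lemma bracket_tangent (X Y : vfield) p : bracket_val X Y p \in is_tangent p.
Proof.
apply/asboolP => i e ie.
have [xi xis xiP] := vfP X i; have [up ups upP] := vfP Y i.
exists ('D_(xi e) up e - 'D_(up e) xi e) => f; rewrite /bracket_val.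
by case: asboolP => // fs; exact: bracket_comp.
Qed.

Lemma bracket_smooth (X Y : vfield) :
  smooth_vf (fun p => Tangent (bracket_tangent X Y p)).
Proof.
move=> i; have [xi xis xiP] := vfP X i; have [up ups upP] := vfP Y i.
exists (fun e => 'D_(xi e) up e - 'D_(up e) xi e) => [j|e p ie f fs]; last first.
  by rewrite /= /bracket_val asboolT//; exact: bracket_comp.
have oD : open (dom i) by exact: open_dom.
pose h := fun e => 'D_(xi e) (fun x => up x 0 j) e + - 'D_(up e) (fun x => xi x 0 j) e.
apply: (@smooth_ext _ _ _ h) => //.
  move=> x Dx; rewrite !mxE !derive_coord//; first exact: smooth_map_diff xis Dx.
  exact: smooth_map_diff ups Dx.
apply: smoothD => //; last apply: smoothN => //.
  exact: smooth_derive_along oD xis (ups j).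
exact: smooth_derive_along oD ups (xis j).
Qed.

Definition bracket (X Y : vfield) : vfield := VField (bracket_smooth X Y).

End Atlas.

Lemma smooth_local {R : realType} {m : nat} (A : set 'rV[R]_m) f :
  (forall x, A x -> smooth_at x f) -> smooth A f.
Proof.
move=> fs k; have {fs} : forall x, A x -> exists2 B, B x & Ck k B f.
  by move=> x /fs[B [_ Bx fB]]; exists B.
elim: k f => [|k IH] f fs; first by move=> x /fs[B Bx]; exact.
split=> [x /fs[B Bx [+ _]]|v]; first exact.
by apply: IH => x /fs[B Bx [_ /(_ v)]]; exists B.
Qed.

Section SubMx.
Context {R : realType} {n : nat}.

Lemma derive_linear {m p} (f : {linear 'rV[R]_m -> 'rV[R]_p}) (e w : 'rV[R]_m) :
  continuous f -> 'D_w f e = f w.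
Proof.
by move=> cf; rewrite deriveE; [rewrite diff_lin|exact: linear_differentiable].
Qed.

Lemma smooth_lsubmx (A : set 'rV[R]_(n + n)) :
  smooth_map A (lsubmx : 'rV_(n + n) -> 'rV_n).
Proof.
move=> j; rewrite (_ : (fun x => _) = fun x : 'rV_(n + n) => x 0 (lshift n j)).
  exact: smooth_coord.
by apply/funext => x; rewrite mxE.
Qed.

Lemma smooth_rsubmx (A : set 'rV[R]_(n + n)) :
  smooth_map A (rsubmx : 'rV_(n + n) -> 'rV_n).
Proof.
move=> j; rewrite (_ : (fun x => _) = fun x : 'rV_(n + n) => x 0 (rshift n j)).
  exact: smooth_coord.
by apply/funext => x; rewrite mxE.
Qed.

Lemma smooth_row_mx (A : set 'rV[R]_(n + n)) (F G : 'rV[R]_(n + n) -> 'rV[R]_n) :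
  smooth_map A F -> smooth_map A G -> smooth_map A (fun x => row_mx (F x) (G x)).
Proof.
move=> Fs Gs k; case: (split_ordP k) => j ->.
  rewrite (_ : (fun x => _) = fun x => F x 0 j); first exact: Fs.
  by apply/funext => x; rewrite row_mxEl.
rewrite (_ : (fun x => _) = fun x => G x 0 j); first exact: Gs.
by apply/funext => x; rewrite row_mxEr.
Qed.

End SubMx.

Record chart (R : realType) (n : nat) (M : topologicalType) := Chart {
  source : set M;
  target : set 'rV[R]_n;
  coord : M -> 'rV[R]_n;
  param : 'rV[R]_n -> M;
  source_open : open source;
  target_open : open target;
  coord_target : forall x, source x -> target (coord x);
  param_source : forall a, target a -> source (param a);
  coordK : forall x, source x -> param (coord x) = x;
  paramK : forall a, target a -> coord (param a) = a;
  chart_continuous : forall x, source x -> {for x, continuous coord};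
  param_continuous : forall a, target a -> {for a, continuous param} }.

Definition paracompact (T : topologicalType) :=
  forall U : set (set T), U `<=` open -> \bigcup_(A in U) A = setT ->
  exists V : set (set T), [/\ V `<=` open, \bigcup_(A in V) A = setT,
    forall A, V A -> exists2 B, U B & A `<=` B &
    forall x : T, exists2 W, nbhs x W & finite_set [set A | V A /\ A `&` W !=set0]].

Record manifold (R : realType) (n : nat) := Manifold {
  mspace :> topologicalType;
  mindex : Type;
  mchart : mindex -> chart R n mspace;
  mhausdorff : hausdorff_space mspace;
  mparacompact : paracompact mspace;
  mcover : forall x, exists i, source (mchart i) x;
  mtransition : forall i j,
    smooth_map (target (mchart i) `&` param (mchart i) @^-1` source (mchart j))
               (coord (mchart j) \o param (mchart i)) }.

Section Base.
Context {R : realType} {n : nat} (M : manifold R n).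
Implicit Types i j : mindex M.

Definition overlap i j : set 'rV[R]_n :=
  target (mchart i) `&` param (mchart i) @^-1` source (mchart j).

Definition transition i j := coord (mchart j) \o param (mchart i).

Lemma open_overlap i j : open (overlap i j).
Proof.
rewrite openE => a [ta sa]; apply: (@filterI _ (nbhs a)).
  by apply: open_nbhs_nbhs; split=> //; exact: target_open.
have pc := param_continuous ta.
by apply: pc; apply: open_nbhs_nbhs; split=> //; exact: source_open.
Qed.

Definition par_base i (a : 'rV[R]_n) : option M :=
  if `[< target (mchart i) a >] then Some (param (mchart i) a) else None.

Lemma par_baseP i a x :
  par_base i a = Some x <-> target (mchart i) a /\ param (mchart i) a = x.
Proof.
by rewrite /par_base; case: asboolP => ta; split; [case=> <-|case=> _ ->| |case].
Qed.

Lemma par_base_open i : open [set a | isSome (par_base i a)].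
Proof.
rewrite (_ : [set a | _] = target (mchart i)); first exact: target_open.
by apply/seteqP; split => a /=; rewrite /par_base; case: asboolP.
Qed.

Lemma par_base_cover x : exists i a, par_base i a = Some x.
Proof.
have [i sx] := mcover x; exists i, (coord (mchart i) x).
by apply/par_baseP; split; [exact: coord_target|exact: coordK].
Qed.

Lemma par_base_compat i j a a' x :
  par_base i a = Some x -> par_base j a' = Some x ->
  exists A (T : 'rV[R]_n -> 'rV[R]_n), [/\ open A, A a, T a = a', smooth_map A T &
    forall y, A y -> par_base j (T y) = par_base i y].
Proof.
move=> /par_baseP[ta ax] /par_baseP[ta' a'x].
exists (overlap i j), (transition i j); split.
- exact: open_overlap.
- by split => //=; rewrite ax -a'x; exact: param_source.
- by rewrite /transition /= ax -a'x paramK.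
- exact: mtransition.
- move=> y [ty sy]; rewrite [RHS]/par_base asboolT//; apply/par_baseP.
  by split; [exact: coord_target|exact: coordK].
Qed.

Definition base : atlas R n :=
  Atlas par_base_open par_base_cover par_base_compat.

End Base.

Notation tangentM x := (@tangent _ _ (base _) x).

Section SlitBundle.
Context {R : realType} {n : nat} (M : manifold R n).
Implicit Types (i j : mindex M) (x y : M) (a b : 'rV[R]_n) (e : 'rV[R]_(n + n)).

(* The tangent vector \sum_k b_k d/dx^k at the point with coordinates [a]; it is
   only used when [a] lies in the range of the chart [i]. *)
Definition cvec i a b : tangentM (param (mchart i) a) :=
  insubd (0 : tangentM (param (mchart i) a))
         (dir (N := base M) (param (mchart i) a) i a b).

Lemma cvec_comp i a b : target (mchart i) a ->
  is_comp (N := base M) i a b (cvec i a b).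
Proof.
move=> ta f fs; rewrite /cvec.
have ia : par (base M) i a = Some (param (mchart i) a) by apply/par_baseP.
have vE := insubdK (0 : tangentM (param (mchart i) a)) (dir_tangent b ia).
by rewrite -[LHS]/(val _ f) vE /dir asboolT.
Qed.

Lemma coord_smooth i a k : target (mchart i) a ->
  smooth_germ (N := base M) (param (mchart i) a) (fun x => coord (mchart i) x 0 k).
Proof.
move=> ta; have ia : par (base M) i a = Some (param (mchart i) a) by apply/par_baseP.
apply: (smooth_germ_chart ia); exists (target (mchart i)); split=> //.
  exact: target_open.
apply: smooth_ext (smooth_coord (target (mchart i)) k) => [|y ty].
  exact: target_open.
by rewrite /pull /= /par_base asboolT//= paramK.
Qed.

Lemma cvec_coord i a b k : target (mchart i) a ->
  cvec i a b (fun x => coord (mchart i) x 0 k) = b 0 k.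
Proof.
move=> ta; rewrite (cvec_comp b ta (coord_smooth k ta)).
rewrite -[RHS](_ : 'D_b (fun a : 'rV[R]_n => a 0 k) a = b 0 k).
  apply: near_eq_derive.
  have n0 : \forall y \near a, target (mchart i) y.
    by apply: open_near ta _ => //; exact: target_open.
  by apply: filterS n0 => y ty; rewrite /pull /= /par_base asboolT//= paramK.
have := derive_id a b.
by rewrite derive_mx; [move/matrixP/(_ 0 k); rewrite mxE|exact: derivable_id].
Qed.

Lemma cvec_neq0 i a b : target (mchart i) a -> (cvec i a b != 0) = (b != 0).
Proof.
move=> ta; apply/idP/idP; [apply: contra_neq => ->|apply: contra_neq => c0].
  by apply: tangentP => f fs; rewrite (cvec_comp _ ta fs) derive0.
by apply/rowP => k; rewrite -(cvec_coord b k ta) c0 mxE.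
Qed.

(* The bundle of nonzero tangent vectors of M. *)
Record slit := Slit {
  slit_pt : {x : M & tangentM x};
  slit_neq0 : tagged slit_pt != 0 }.

HB.instance Definition _ := [isSub for slit_pt].

Definition foot (u : slit) : M := tag (slit_pt u).
Definition vec (u : slit) : tangentM (foot u) := tagged (slit_pt u).

Definition mk_slit x (v : tangentM x) : option slit :=
  insub (Tagged (fun x : M => tangentM x) v).

Lemma tagged_eqP x y (v : tangentM x) (w : tangentM y) : x = y ->
  (forall f, smooth_germ (N := base M) x f -> v f = w f) ->
  Tagged (fun x : M => tangentM x) v = Tagged (fun x : M => tangentM x) w.
Proof. by move=> xy; subst y => vw; congr Tagged; exact: tangentP. Qed.

Lemma mk_slit_eq x y (v : tangentM x) (w : tangentM y) : x = y ->
  (forall f, smooth_germ (N := base M) x f -> v f = w f) -> mk_slit v = mk_slit w.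
Proof. by move=> xy vw; rewrite /mk_slit (tagged_eqP xy vw). Qed.

Lemma mk_slitP x (v : tangentM x) u :
  mk_slit v = Some u <-> slit_pt u = Tagged (fun x : M => tangentM x) v.
Proof.
rewrite /mk_slit; split; first by case: insubP => // ? _ <- [->].
move=> uv; case: insubP => [w _ wv|]; first by congr Some; apply: val_inj; rewrite wv.
by move/negP => []; rewrite -uv; exact: slit_neq0.
Qed.

Lemma mk_slit_vec u : mk_slit (vec u) = Some u.
Proof. by apply/mk_slitP; case: u => -[x v] v0. Qed.

(* The induced coordinates (x^k, y^k), stored as [e = row_mx x y]. *)
Definition par_slit i e : option slit :=
  if `[< target (mchart i) (lsubmx e) >]
  then mk_slit (cvec i (lsubmx e) (rsubmx e)) else None.

Lemma par_slitP i e u : par_slit i e = Some u <->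
  [/\ target (mchart i) (lsubmx e), param (mchart i) (lsubmx e) = foot u &
      is_comp (N := base M) i (lsubmx e) (rsubmx e) (vec u)].
Proof.
rewrite /par_slit; case: asboolP => [te|nte]; last by split=> // -[].
split=> [/mk_slitP|[_ pe vc]].
  rewrite /vec /foot; case: u => -[x v] v0 /= uE.
  have xE : x = param (mchart i) (lsubmx e) by have := congr1 (@tag _ _) uE.
  split=> // f fs; rewrite (congr1 (fun s => tval (tagged s) f) uE) /=.
  by apply: cvec_comp te _ _; rewrite -xE.
rewrite -(mk_slit_vec u); apply: mk_slit_eq => // f fs.
by rewrite (cvec_comp _ te fs) vc// -pe.
Qed.

Definition slit_dom i : set 'rV[R]_(n + n) :=
  lsubmx @^-1` target (mchart i) `&` [set e | rsubmx e != 0].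

Lemma par_slit_some i e : isSome (par_slit i e) <-> slit_dom i e.
Proof.
rewrite /par_slit /slit_dom; case: asboolP => te /=; last by split=> // -[].
have := cvec_neq0 (rsubmx e) te; rewrite /mk_slit.
by case: insubP => [w h _|/negP h] <- //=; split=> // -[].
Qed.

Lemma open_neq0 (A : set 'rV[R]_n) : open A ->
  open ((lsubmx : 'rV[R]_(n + n) -> 'rV_n) @^-1` A `&` [set e | rsubmx e != 0]).
Proof.
move=> oA; apply: openI.
  by apply: open_comp => // e _; exact: continuous_lsubmx.
rewrite (_ : [set e | _] = (rsubmx : 'rV[R]_(n + n) -> 'rV_n) @^-1` ~` [set 0]).
  apply: open_comp; first by move=> e _; exact: continuous_rsubmx.
  by apply: closed_openC; apply: accessible_closed_set1; apply: hausdorff_accessible; exact: norm_hausdorff.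
by apply/seteqP; split=> e /= /eqP.
Qed.

Lemma par_slit_open i : open [set e | isSome (par_slit i e)].
Proof.
rewrite (_ : [set e | _] = slit_dom i).
  by apply: open_neq0; exact: target_open.
by apply/seteqP; split=> e /= /par_slit_some.
Qed.

Lemma par_slit_row u i a : par (base M) i a = Some (foot u) ->
  exists b, par_slit i (row_mx a b) = Some u.
Proof.
move=> ia; have /asboolP/(_ _ _ ia)[b bP] := tvalP (vec u).
exists b; move/par_baseP: ia => [ta ax].
apply/par_slitP; rewrite row_mxKl row_mxKr; split=> // f fs.
by rewrite bP asboolT.
Qed.

Lemma par_slit_base i e u : par_slit i e = Some u ->
  par (base M) i (lsubmx e) = Some (foot u).
Proof. by move=> /par_slitP[ta ax _]; apply/par_baseP. Qed.

Lemma par_slit_cover u : exists i e, par_slit i e = Some u.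
Proof.
have [i [a ia]] := @par_cover _ _ (base M) (foot u).
by have [b ib] := par_slit_row ia; exists i, (row_mx a b).
Qed.

Lemma comp_transition i j a b f : overlap i j a ->
  smooth_germ (N := base M) (param (mchart i) a) f ->
  'D_b (pull (N := base M) i f) a =
  'D_('D_b (transition i j) a) (pull (N := base M) j f) (transition i j a).
Proof.
move=> ija fs; have [ta sa] := ija.
have jta : par (base M) j (transition i j a) = Some (param (mchart i) a).
  by apply/par_baseP; split; [exact: coord_target|exact: coordK].
have dt := smooth_map_diff (@mtransition _ _ M i j) ija.
rewrite -(derive_comp b dt (smooth_germ_diff jta fs)).
apply: near_eq_derive.
have n0 : \forall y \near a, overlap i j y.
  by apply: open_near ija _ => //; exact: open_overlap.
apply: filterS n0 => y [ty sy]; rewrite /pull /= /par_base !asboolT//=.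
  by rewrite coordK.
exact: coord_target.
Qed.

Definition dtransition i j e : 'rV[R]_(n + n) :=
  row_mx (transition i j (lsubmx e)) ('D_(rsubmx e) (transition i j) (lsubmx e)).

Lemma par_slit_transition i j e : overlap i j (lsubmx e) ->
  par_slit j (dtransition i j e) = par_slit i e.
Proof.
move=> ije; have [te se] := ije.
have tj : target (mchart j) (transition i j (lsubmx e)) by exact: coord_target.
rewrite /par_slit /dtransition row_mxKl row_mxKr !asboolT//.
have pE : param (mchart j) (transition i j (lsubmx e)) = param (mchart i) (lsubmx e).
  exact: coordK.
apply: mk_slit_eq => // f fs; rewrite (cvec_comp _ tj fs).
by rewrite pE in fs; rewrite (cvec_comp _ te fs) (comp_transition _ ije fs).
Qed.

Lemma smooth_dtransition i j :
  smooth_map (lsubmx @^-1` overlap i j `&` [set e | rsubmx e != 0]) (dtransition i j).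
Proof.
set A := _ `&` _; have oA : open A by apply: open_neq0; exact: open_overlap.
have ts := @mtransition _ _ M i j; have AO e : A e -> overlap i j (lsubmx e) by case.
apply: smooth_row_mx => k.
  exact: (smooth_comp oA AO (smooth_lsubmx A) (ts k)).
pose tk := fun a => transition i j a 0 k.
pose h e := \sum_l rsubmx e 0 l * ('D_(delta_mx 0 l) tk \o lsubmx) e.
apply: (@smooth_ext _ _ _ h) => // [e Ae|].
  rewrite (derive_coord _ _ (smooth_map_diff ts (AO _ Ae))).
  by rewrite (derive_sum_delta _ (smooth_diff (ts k) (AO _ Ae))).
apply: smooth_sum => // l; apply: smoothM => //; first exact: smooth_rsubmx.
exact: (smooth_comp oA AO (smooth_lsubmx A) (smooth_derive _ (ts k))).
Qed.

Lemma par_slit_compat i j e e' u :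
  par_slit i e = Some u -> par_slit j e' = Some u ->
  exists A (T : 'rV[R]_(n + n) -> 'rV[R]_(n + n)),
    [/\ open A, A e, T e = e', smooth_map A T &
        forall z, A z -> par_slit j (T z) = par_slit i z].
Proof.
move=> ie je'; have ne : slit_dom i e by apply/par_slit_some; rewrite ie.
have [te pe ec] := (par_slitP _ _ _).1 ie.
have [te' pe' ec'] := (par_slitP _ _ _).1 je'.
have ije : overlap i j (lsubmx e).
  by split=> //=; rewrite pe -pe'; exact: param_source.
have tE : transition i j (lsubmx e) = lsubmx e'.
  by rewrite /transition /= pe -pe' paramK.
exists (lsubmx @^-1` overlap i j `&` [set e | rsubmx e != 0]), (dtransition i j).
split.
- by apply: open_neq0; exact: open_overlap.
- by split=> //; case: ne.
- rewrite /dtransition tE -[RHS]hsubmxK; congr row_mx; apply/rowP => k.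
  rewrite -(cvec_coord _ k te') -[RHS](cvec_coord _ k te').
  rewrite !(cvec_comp _ te' (coord_smooth k te')).
  have fs := coord_smooth k te'; rewrite pe' in fs.
  rewrite -(ec' _ fs) (ec _ fs) -[in LHS]tE -comp_transition//.
  by rewrite pe.
- exact: smooth_dtransition.
- by move=> x [] ox _; exact: par_slit_transition.
Qed.

Definition slit_atlas : atlas R (n + n) :=
  Atlas par_slit_open par_slit_cover par_slit_compat.

End SlitBundle.

Section PiFields.
Context {R : realType} {n : nat} (M : manifold R n).
Local Notation TM := (slit_atlas M).
Implicit Types (u : slit M) (i : mindex M) (e : 'rV[R]_(n + n)).

(* The fibre of pi^{-1}(TM) over [u] is {u} x T_{pi u} M, represented by
   T_{pi u} M itself. *)
Definition smooth_pvf (Y : forall u : slit M, tangentM (foot u)) :=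
  forall i, exists2 c : 'rV[R]_(n + n) -> 'rV[R]_n, smooth_map (dom (N := TM) i) c &
    forall e u, par TM i e = Some u ->
      is_comp (N := base M) i (lsubmx e) (c e) (Y u).

Record pvfield := PVField {
  pvf :> forall u : slit M, tangentM (foot u);
  pvfP : smooth_pvf pvf }.

Lemma pvfieldP (Y Z : pvfield) : (forall u, Y u = Z u) -> Y = Z.
Proof.
case: Y Z => Y Ys [Z Zs] /= YZ.
have {}YZ : Y = Z by apply: functional_extensionality_dep.
by subst Y; congr PVField; exact: Prop_irrelevance.
Qed.

HB.instance Definition _ := gen_eqMixin pvfield.
HB.instance Definition _ := gen_choiceMixin pvfield.

Lemma pull_smooth_diff i e u f : par TM i e = Some u ->
  smooth_germ (N := base M) (foot u) f ->
  differentiable (pull (N := base M) i f) (lsubmx e).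
Proof. by move=> ie fs; exact: smooth_germ_diff (par_slit_base ie) fs. Qed.

Lemma pvf_zero_smooth : smooth_pvf (fun u => 0).
Proof.
move=> i; exists (fun=> 0) => [j|e u ie f fs]; last by rewrite derive0.
rewrite (_ : (fun=> _) = fun=> 0); first exact: smooth_cst.
by apply/funext => e; rewrite mxE.
Qed.

Lemma pvf_add_smooth (Y Z : pvfield) : smooth_pvf (fun u => Y u + Z u).
Proof.
move=> i; have [c cs cP] := pvfP Y i; have [d ds dP] := pvfP Z i.
exists (fun e => c e + d e) => [j|e u ie f fs].
  apply: smooth_ext (smoothD _ (cs j) (ds j)); [exact: open_dom| |exact: open_dom].
  by move=> x _; rewrite mxE.
rewrite (deriveD_dir _ _ (pull_smooth_diff ie fs)).
by rewrite -(cP _ _ ie _ fs) -(dP _ _ ie _ fs).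
Qed.

Lemma smooth_fun_dom (f : TM -> R) i : smooth_fun f -> smooth (dom (N := TM) i) (pull (N := TM) i f).
Proof.
move=> fs; apply: smooth_local => e /domP[u ie]; exact: (fs u i e ie).
Qed.

Lemma pvf_scale_smooth (f : TM -> R) (Y : pvfield) : smooth_fun f ->
  smooth_pvf (fun u => f u *: Y u).
Proof.
move=> fs i; have [c cs cP] := pvfP Y i.
exists (fun e => pull (N := TM) i f e *: c e) => [j|e u ie h hs].
  apply: smooth_ext (smoothM _ (smooth_fun_dom i fs) (cs j));
    [exact: open_dom| |exact: open_dom].
  by move=> x _; rewrite mxE.
rewrite (deriveZ_dir _ _ (pull_smooth_diff ie hs)) (pullE _ ie).
by rewrite -(cP _ _ ie _ hs).
Qed.

Lemma smooth_fun_cst (c : R) : smooth_fun (N := TM) (fun=> c).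
Proof.
move=> u i e ie; exists (dom (N := TM) i); split; [exact: open_dom|exact: domS ie|].
apply: smooth_ext (smooth_cst _ c); first exact: open_dom.
by move=> x /domP[p ip]; rewrite (pullE _ ip).
Qed.

Definition pvf_zero : pvfield := PVField pvf_zero_smooth.
Definition pvf_add (Y Z : pvfield) : pvfield := PVField (pvf_add_smooth Y Z).
Definition pvf_scale (f : TM -> R) (fs : smooth_fun f) (Y : pvfield) : pvfield :=
  PVField (pvf_scale_smooth Y fs).
Definition pvf_opp : pvfield -> pvfield := pvf_scale (smooth_fun_cst (-1)).

Lemma pvf_addA : associative pvf_add.
Proof. by move=> X Y Z; apply: pvfieldP => u; exact: addrA. Qed.
Lemma pvf_addC : commutative pvf_add.
Proof. by move=> X Y; apply: pvfieldP => u; exact: addrC. Qed.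
Lemma pvf_add0 : left_id pvf_zero pvf_add.
Proof. by move=> X; apply: pvfieldP => u; exact: add0r. Qed.
Lemma pvf_addN : left_inverse pvf_zero pvf_opp pvf_add.
Proof. by move=> X; apply: pvfieldP => u; rewrite /= scaleN1r addNr. Qed.

HB.instance Definition _ :=
  GRing.isZmodule.Build pvfield pvf_addA pvf_addC pvf_add0 pvf_addN.

Lemma eta_smooth : smooth_pvf (@vec R n M).
Proof.
move=> i; exists rsubmx => [|e u ie]; first exact: smooth_rsubmx.
by have [_ _] := (par_slitP _ _ _).1 ie.
Qed.

Definition eta : pvfield := PVField eta_smooth.

(* d pi (v) h = v (h o pi). *)
Definition rho_val u (v : tangent (N := TM) u) : (base M -> R) -> R := fun h =>
  if `[< smooth_germ (N := base M) (foot u) h >] then v (h \o @foot R n M) else 0.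

Lemma pull_proj i e h : dom (N := TM) i e ->
  pull (N := TM) i (h \o @foot R n M) e = pull (N := base M) i h (lsubmx e).
Proof.
move=> /domP[u ie]; rewrite (pullE (N := TM) _ ie).
by rewrite (pullE (N := base M) _ (par_slit_base ie)).
Qed.

Lemma smooth_germ_proj u h : smooth_germ (N := base M) (foot u) h ->
  smooth_germ (N := TM) u (h \o @foot R n M).
Proof.
move=> hs i e ie.
have [A [oA Ae Ad hA _]] := smooth_germ_open (par_slit_base ie) hs.
have oB : open ((lsubmx : 'rV[R]_(n + n) -> 'rV_n) @^-1` A).
  by apply: open_comp => // x _; exact: continuous_lsubmx.
have oC : open (lsubmx @^-1` A `&` dom (N := TM) i).
  by apply: openI => //; exact: open_dom.
exists (lsubmx @^-1` A `&` dom (N := TM) i); split=> //.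
  by split=> //; exact: domS ie.
apply: smooth_ext (smooth_comp oC _ (smooth_lsubmx _) hA) => //.
  by move=> x [_ dx]; rewrite /= pull_proj.
by move=> x [].
Qed.

Lemma rho_comp i e u w (v : tangent (N := TM) u) h : par TM i e = Some u ->
  is_comp (N := TM) i e w v -> smooth_germ (N := base M) (foot u) h ->
  v (h \o @foot R n M) = 'D_(lsubmx w) (pull (N := base M) i h) (lsubmx e).
Proof.
move=> ie vw hs; rewrite (vw _ (smooth_germ_proj hs)).
have dl : differentiable (lsubmx : 'rV[R]_(n + n) -> 'rV_n) e.
  exact: differentiable_lsubmx.
have -> : lsubmx w = 'D_w (lsubmx : 'rV[R]_(n + n) -> 'rV_n) e.
  by rewrite derive_linear//; exact: continuous_lsubmx.
rewrite -(derive_comp w dl (pull_smooth_diff ie hs)).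
apply: near_eq_derive.
have n0 : \forall x \near e, dom (N := TM) i x.
  by apply: open_near (domS ie) _ => //; exact: open_dom.
by apply: filterS n0 => x dx; rewrite /= pull_proj.
Qed.

Lemma rho_tangent u (v : tangent (N := TM) u) :
  rho_val v \in is_tangent (N := base M) (foot u).
Proof.
apply/asboolP => i a ia; have [b ib] := par_slit_row ia.
have /asboolP/(_ _ _ ib)[w wP] := tvalP v.
exists (lsubmx w) => h; rewrite /rho_val; case: asboolP => // hs.
have vw : is_comp (N := TM) i (row_mx a b) w v.
  by move=> f fs; rewrite wP asboolT.
by rewrite (rho_comp ib vw hs) row_mxKl.
Qed.

Definition rho u (v : tangent (N := TM) u) : tangentM (foot u) :=
  Tangent (rho_tangent v).

Lemma rho_smooth (X : vfield TM) : smooth_pvf (fun u => rho (X u)).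
Proof.
move=> i; have [xi xis xiP] := vfP X i.
exists (lsubmx \o xi) => [j|e u ie h hs].
  rewrite (_ : (fun x => _) = fun x => xi x 0 (lshift n j)); first exact: xis.
  by apply/funext => x; rewrite /= mxE.
by rewrite /= /rho_val asboolT// (rho_comp ie (xiP _ _ ie) hs).
Qed.

Definition rho_vf (X : vfield TM) : pvfield := PVField (rho_smooth X).

(* Extension by 0 of a function on nonzero tangent vectors to all of TM. *)
Definition ext (f : slit M -> R) (x : M) (v : tangentM x) : R :=
  oapp f 0 (mk_slit v).

(* The vertical lift: f |-> d/dt f (u + t w) at t = 0. *)
Definition gamma_val u (w : tangentM (foot u)) : (TM -> R) -> R := fun f =>
  if `[< smooth_germ (N := TM) u f >] then 'D_1 (fun t : R => ext f (vec u + t *: w)) 0 else 0.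

Lemma gamma_comp i e u c (w : tangentM (foot u)) f : par TM i e = Some u ->
  is_comp (N := base M) i (lsubmx e) c w -> smooth_germ (N := TM) u f ->
  'D_1 (fun t : R => ext f (vec u + t *: w)) 0 = 'D_(row_mx 0 c) (pull (N := TM) i f) e.
Proof.
move=> ie wc fs; rewrite -(derive_line _ (smooth_germ_diff ie fs)).
congr (derive _ (0 : R) (1 : R)); apply/funext => t; rewrite /ext /pull; congr oapp.
have [te pe ec] := (par_slitP _ _ _).1 ie.
have -> : e + t *: row_mx 0 c = row_mx (lsubmx e) (rsubmx e + t *: c).
  by rewrite -[e in LHS]hsubmxK scale_row_mx add_row_mx scaler0 addr0.
rewrite /= /par_slit row_mxKl row_mxKr asboolT//; apply: mk_slit_eq => // h hs.
have ps : smooth_germ (N := base M) (param (mchart i) (lsubmx e)) h by rewrite pe.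
rewrite (cvec_comp _ te ps) -[LHS]/(vec u h + t * w h).
have dh := pull_smooth_diff ie hs.
by rewrite (deriveD_dir _ _ dh) (deriveZ_dir _ _ dh) (ec _ hs) (wc _ hs).
Qed.

Lemma gamma_tangent u (w : tangentM (foot u)) :
  gamma_val w \in is_tangent (N := TM) u.
Proof.
apply/asboolP => i e ie.
have /asboolP/(_ _ _ (par_slit_base ie))[c cP] := tvalP w.
exists (row_mx 0 c) => f; rewrite /gamma_val; case: asboolP => // fs.
by apply: gamma_comp ie _ fs => h hs; rewrite cP asboolT.
Qed.

Definition gamma u (w : tangentM (foot u)) : tangent (N := TM) u :=
  Tangent (gamma_tangent w).

Lemma gamma_smooth (Y : pvfield) : smooth_vf (N := TM) (fun u => gamma (Y u)).
Proof.
move=> i; have [c cs cP] := pvfP Y i.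
exists (fun e => row_mx 0 (c e)) => [|e u ie f fs].
  apply: smooth_row_mx => // j.
  rewrite (_ : (fun=> _) = fun=> 0); first exact: smooth_cst.
  by apply/funext => x; rewrite mxE.
by rewrite /= /gamma_val asboolT//; exact: gamma_comp ie (cP _ _ ie) fs.
Qed.

Definition gamma_vf (Y : pvfield) : vfield TM := VField (gamma_smooth Y).

(* A linear connection is tensorial in the direction, so [conn D u v Y] is
   D_v Y for a single tangent vector [v] at [u]; [cov] below is the operator
   on vector fields. *)
Record connection := Connection {
  conn :> forall u : slit M, tangent (N := TM) u -> pvfield -> tangentM (foot u);
  conn_linear : forall u (a : R) (v w : tangent (N := TM) u) Y,
    conn (a *: v + w) Y = a *: conn v Y + conn w Y;
  conn_add : forall u (v : tangent (N := TM) u) Y Z,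
    conn v (Y + Z) = conn v Y + conn v Z;
  conn_leibniz : forall u (v : tangent (N := TM) u) f (fs : smooth_fun f) Y,
    conn v (pvf_scale fs Y) = v f *: Y u + f u *: conn v Y;
  conn_smooth : forall (X : vfield TM) Y, smooth_pvf (fun u => conn (X u) Y) }.

Definition cov (D : connection) (X : vfield TM) (Y : pvfield) : pvfield :=
  PVField (conn_smooth D X Y).

Definition torsion (D : connection) (X Y : vfield TM) : pvfield :=
  cov D X (rho_vf Y) - cov D Y (rho_vf X) - rho_vf (bracket X Y).

(* The sign is opposite to the one of [D_X, D_Y] - D_[X, Y]. *)
Definition curvature (D : vfield TM -> pvfield -> pvfield) (X Y : vfield TM)
    (Z : pvfield) : pvfield :=
  - D X (D Y Z) + D Y (D X Z) + D (bracket X Y) Z.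

Definition conn_map (D : connection) (X : vfield TM) : pvfield := cov D X eta.

(* T_u = V_u (+) ker K_u, where V_u = ker rho_u. *)
Definition regular (D : connection) := forall u,
  (forall v : tangent (N := TM) u, rho v = 0 -> D u v eta = 0 -> v = 0) /\
  (forall v : tangent (N := TM) u, exists v1 v2,
    [/\ v = v1 + v2, rho v1 = 0 & D u v2 eta = 0]).

(* The horizontal map beta = (rho restricted to ker K)^{-1}, acting on sections,
   is carried along with the connection.  It is no extra choice: by regularity
   at most one map satisfies [hmap_rho] and [hmap_ker]. *)
Record regular_connection := RegularConnection {
  rconn :> connection;
  rconn_regular : regular rconn;
  hmap : pvfield -> vfield TM;
  hmap_rho : forall Y, rho_vf (hmap Y) = Y;
  hmap_ker : forall Y, conn_map rconn (hmap Y) = 0 }.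

Section Regular.
Variable D : regular_connection.

Definition h_torsion (X Y : pvfield) : pvfield := torsion D (hmap D X) (hmap D Y).
Definition hv_torsion (X Y : pvfield) : pvfield := torsion D (gamma_vf X) (hmap D Y).

(* \hat P (X, Y) = P (X, Y) eta. *)
Definition hv_curvature_eta (X Y : pvfield) : pvfield :=
  curvature (cov D) (hmap D X) (gamma_vf Y) eta.

(* [D] is meant to be the Cartan connection in the definitions of the Berwald
   connection and of its h-, hv- and v-curvatures; the two connections have the
   same horizontal map. *)
Definition berwald (X : vfield TM) (Y : pvfield) : pvfield :=
  cov D X Y + hv_curvature_eta (rho_vf X) Y - hv_torsion (conn_map D X) Y.

Definition berwald_h (X Y Z : pvfield) : pvfield :=
  curvature berwald (hmap D X) (hmap D Y) Z.
Definition berwald_hv (X Y Z : pvfield) : pvfield :=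
  curvature berwald (hmap D X) (gamma_vf Y) Z.
Definition berwald_v (X Y Z : pvfield) : pvfield :=
  curvature berwald (gamma_vf X) (gamma_vf Y) Z.

Definition concurrent (zeta : pvfield) := forall X : pvfield,
  cov D (hmap D X) zeta = - X /\ cov D (gamma_vf X) zeta = 0.

End Regular.

(* The fibre Hessian of L^2 / 2, i.e. g_ij = (1/2) d^2 L^2 / dy^i dy^j. *)
Definition fmetric (L : slit M -> R) u (v w : tangentM (foot u)) : R :=
  2^-1 * 'D_1 (fun s : R =>
    'D_1 (fun t : R => ext (fun u => L u ^+ 2) (vec u + s *: v + t *: w)) 0) 0.

(* L lives on nonzero vectors only: its extension by 0 to TM is automatically
   continuous, by homogeneity. *)
Definition finsler (L : slit M -> R) :=
  [/\ smooth_fun (N := TM) L,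
      forall u, 0 < L u,
      forall u (c : R), 0 < c -> ext L (c *: vec u) = c * L u &
      forall u (v : tangentM (foot u)), v != 0 -> 0 < fmetric L v v].

(* nabla g = 0, Q = 0 and the symmetry of the (h)hv-torsion; regularity is part
   of the type of [D]. *)
Definition cartan (L : slit M -> R) (D : regular_connection) :=
  [/\ forall (X : vfield TM) (Y Z : pvfield) u,
        X u (fun u => fmetric L (Y u) (Z u)) =
        fmetric L (cov D X Y u) (Z u) + fmetric L (Y u) (cov D X Z u),
      forall X Y, h_torsion D X Y = 0 &
      forall (X Y Z : pvfield) u, fmetric L (hv_torsion D X Y u) (Z u) =
                      fmetric L (hv_torsion D X Z u) (Y u)].

(* \tilde L^2 = L^2 + B^2 with B = g (zeta, eta). *)
Definition energy_change (L : slit M -> R) (zeta : pvfield) (u : slit M) : R :=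
  Num.sqrt (L u ^+ 2 + fmetric L (zeta u) (vec u) ^+ 2).

End PiFields.

(* The operator \mathfrak U. *)
Definition alt {T : Type} {V : zmodType} (A : T -> T -> V) (x y : T) : V :=
  A x y - A y x.

(* Main.v *)
From HB Require Import structures.
Require Import Defs.
From mathcomp Require Import all_boot all_order all_algebra.
From mathcomp Require Import all_classical all_reals topology normedtype derive.
From mathcomp Require Import ring lra.

(** Write [b], [K] and [T] for the horizontal map, the connection map and the
    (h)hv-torsion of the Cartan connection [nabla] of [L], [G = b eta] for its
    spray, [phi = 1 / (1 + p^2)] and [B = g (zeta, eta)].

    The Berwald connection is determined by the horizontal map alone
    ([berwaldE]): it is the fibrewise derivative [vder] on vertical vectors and
    [Y |-> K [b X, gamma Y]] on horizontal ones.  So everything comes down to the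
    horizontal map of the changed metric.

    A concurrent section has vanishing vertical derivative: the curvature of
    [nabla] satisfies [P (X, Y) zeta = - T (Y, X)], and since it is
    skew-symmetric, [g (T (Y, X), zeta) = 0], whence [T (_, zeta) = 0]
    ([cartan_tensor_zeta], [vder_zeta]).  Thus [B] is linear in the fibres and the
    changed metric is [g + g (zeta, _) g (zeta, _)] ([changed_metric]).  Its spray
    solves the Euler-Lagrange equation of [L ^ 2 + B ^ 2]
    ([euler_lagrange]); as [d B] is known on horizontal and on vertical
    vectors, this is an algebraic equation, and its solution is
    [G + phi L ^ 2 gamma zeta] ([spray_change]).  The spray determines the
    horizontal map ([hmap_spray]), so the new one is
    [b X + phi g (X, eta) gamma zeta] ([hmap_change]), and the Berwald connection
    changes by the tensor [- phi g (rho X, Y) zeta] ([berwald_change]).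

    The curvature formula then follows by differentiating that tensor
    ([curvature_change]).  This uses that the Berwald connection has no torsion
    and differentiates [g] by means of two totally symmetric tensors
    ([berwald_torsion], [berwald_metric]).  Both facts rest on
    [\hat P = nabla_G T] for the Cartan connection ([phatE]), which follows from
    the first Bianchi identity and the skew-symmetry of the curvature.

    The special cases are obtained by inserting [b X + phi g (X, eta) gamma zeta]
    and [gamma Y] into the formula.  The extra vertical terms vanish because the
    vertical derivative is flat ([vder_flat]) and because the hv-curvature of the
    Berwald connection is symmetric in its last two arguments, which kills it on
    [zeta] ([berwald_curvature_hv_sym], [berwald_curvature_zeta]).

    The vertical calculus needs no connection.  The fibre metric is the vertical
    Hessian of the energy, [2 g (X, Y) = gamma X gamma Y L^2 - gamma (vder X Y) L^2]
    ([fmetric_hessian]), and commuting vertical derivatives makes the Cartan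
    tensor symmetric ([cartan_tensor_sym]).  Coordinates occur only in the proofs
    of the elementary facts about [vder], [gamma], [rho] and this Hessian. *)

Set Implicit Arguments.
Unset Strict Implicit.
Unset Printing Implicit Defensive.

Import Order.TTheory GRing.Theory Num.Theory numFieldNormedType.Exports.

Local Open Scope classical_set_scope.
Local Open Scope ring_scope.

(** * Reciprocals of smooth functions *)

Section SmoothInv.
Context {R : realType} {m : nat}.
Implicit Types (A : set 'rV[R]_m) (f : 'rV[R]_m -> R).

Lemma CkV k A f : open A -> (forall x, A x -> f x != 0) -> Ck k A f ->
  Ck k A (fun x => (f x)^-1).
Proof.
move=> oA f0; elim: k => [|k IH] Cf.
  by move=> x Ax; apply: continuousV; [exact: f0|exact: Cf].
have Cfk := IH (CkS Cf); case: Cf => df Df; split=> [x Ax|v].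
  by apply: differentiableV; [exact: df|exact: f0].
apply: Ck_ext (CkM oA (Ck_cst k A (-1)) (CkM oA (CkM oA Cfk Cfk) (Df v))) => //.
move=> x Ax; rewrite deriveV; [|exact: f0|exact/diff_derivable/df].
by rewrite /GRing.scale /= expr2 invfM mulN1r mulNr.
Qed.

Lemma smoothV A f : open A -> (forall x, A x -> f x != 0) -> smooth A f ->
  smooth A (fun x => (f x)^-1).
Proof. by move=> oA f0 fs k; exact: CkV. Qed.

End SmoothInv.

(** * Derivations of germs *)

Section Germs.
Context {R : realType} {m : nat} {N : atlas R m}.
Implicit Types (p q : N) (f g : N -> R).

Lemma smooth_germ_lift2 (op : R -> R -> R) p f g :
  (forall A (a b : 'rV[R]_m -> R), open A -> smooth A a -> smooth A b ->
     smooth A (fun x => op (a x) (b x))) ->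
  smooth_germ p f -> smooth_germ p g -> smooth_germ p (fun q => op (f q) (g q)).
Proof.
move=> ops fs gs; have [i [e ie]] := par_cover p.
have [A [oA Ae Ad fA _]] := smooth_germ_open ie fs.
have [B [oB Be _ gB _]] := smooth_germ_open ie gs.
have oC := openI oA oB.
apply: smooth_germ_chart ie _; exists (A `&` B); split=> //.
have sf := smooth_sub (@subIsetl _ A B) fA.
have sg := smooth_sub (@subIsetr _ A B) gB.
apply: smooth_ext oC _ (ops _ _ _ oC sf sg) => x [Ax _].
by have [q iq] := domP (Ad _ Ax); rewrite !(pullE _ iq).
Qed.

Lemma smooth_germD p f g : smooth_germ p f -> smooth_germ p g ->
  smooth_germ p (fun q => f q + g q).
Proof. by apply: smooth_germ_lift2 => A a b; exact: smoothD. Qed.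

Lemma smooth_germM p f g : smooth_germ p f -> smooth_germ p g ->
  smooth_germ p (fun q => f q * g q).
Proof. by apply: smooth_germ_lift2 => A a b; exact: smoothM. Qed.

Lemma smooth_germ_cst p (c : R) : smooth_germ p (fun=> c).
Proof.
move=> i e ie; exists (dom i); split; [exact: open_dom|exact: domS ie|].
apply: smooth_ext (smooth_cst _ c); first exact: open_dom.
by move=> x /domP[q iq]; rewrite (pullE _ iq).
Qed.

Lemma smooth_germN p f : smooth_germ p f -> smooth_germ p (fun q => - f q).
Proof.
move=> fs; rewrite (_ : (fun q => _) = fun q => -1 * f q).
  exact/smooth_germM/fs/smooth_germ_cst.
by apply/funext => q; rewrite mulN1r.
Qed.

Lemma smooth_germB p f g : smooth_germ p f -> smooth_germ p g ->
  smooth_germ p (fun q => f q - g q).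
Proof. by move=> fs gs; exact/smooth_germD/smooth_germN. Qed.

Lemma smooth_funV f : (forall p, f p != 0) -> smooth_fun f ->
  smooth_fun (fun q => (f q)^-1).
Proof.
move=> f0 fs p; have [i [e ie]] := par_cover p.
have [A [oA Ae Ad fA _]] := smooth_germ_open ie (fs p).
apply: smooth_germ_chart ie _; exists A; split=> //.
apply: smooth_ext oA _ (smoothV oA _ fA) => x Ax;
  by have [q iq] := domP (Ad _ Ax); rewrite !(pullE _ iq).
Qed.

(** Locality.  Brackets, [rho] and [gamma] are given by their formulas on smooth
    germs only, so that most identities between functions below hold just near
    the point under consideration. *)
Lemma tangent_near i e p (v : tangent p) f g : par N i e = Some p ->
  smooth_germ p f -> smooth_germ p g ->
  (\forall x \near e, pull i f x = pull i g x) -> v f = v g.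
Proof.
move=> ie fs gs fg; have /asboolP/(_ _ _ ie)[b bP] := tvalP v.
by rewrite !bP !asboolT//; exact: near_eq_derive.
Qed.

Lemma tangent_germ p (v : tangent p) f g h : smooth_germ p h ->
  smooth_germ p f -> smooth_germ p g ->
  (forall q, smooth_germ q h -> f q = g q) -> v f = v g.
Proof.
move=> hs fs gs fg; have [i [e ie]] := par_cover p.
have [A [oA Ae Ad _ nA]] := smooth_germ_open ie hs.
apply: tangent_near ie fs gs _; apply: open_near oA Ae _ => x Ax.
have [q iq] := domP (Ad _ Ax); rewrite !(pullE _ iq).
exact/fg/(nA x).
Qed.

Lemma tangent_comp i e p (v : tangent p) : par N i e = Some p ->
  exists b, is_comp i e b v.
Proof.
move=> ie; have /asboolP/(_ _ _ ie)[b bP] := tvalP v.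
by exists b => f fs; rewrite bP asboolT.
Qed.

Lemma pull_near (op : R -> R -> R) i e p f g : par N i e = Some p ->
  \forall x \near e, pull i (fun q => op (f q) (g q)) x = op (pull i f x) (pull i g x).
Proof.
move=> ie; apply: open_near (domS ie) _; first exact: open_dom.
by move=> x /domP[q iq]; rewrite !(pullE _ iq).
Qed.

Lemma tangent_add p (v : tangent p) f g : smooth_germ p f -> smooth_germ p g ->
  v (fun q => f q + g q) = v f + v g.
Proof.
move=> fs gs; have [i [e ie]] := par_cover p; have [b bP] := tangent_comp v ie.
rewrite !bP//; last exact: smooth_germD.
rewrite -deriveD; [|exact/diff_derivable/(smooth_germ_diff ie)..].
exact/near_eq_derive/(pull_near +%R f g ie).
Qed.

Lemma tangent_mul p (v : tangent p) f g : smooth_germ p f -> smooth_germ p g ->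
  v (fun q => f q * g q) = v f * g p + f p * v g.
Proof.
move=> fs gs; have [i [e ie]] := par_cover p; have [b bP] := tangent_comp v ie.
rewrite !bP//; last exact: smooth_germM.
rewrite (near_eq_derive _ (pull_near *%R f g ie)).
rewrite deriveM; [|exact/diff_derivable/(smooth_germ_diff ie)..].
by rewrite !(pullE _ ie) /GRing.scale /= addrC; congr (_ + _); rewrite mulrC.
Qed.

Lemma tangent_cst p (v : tangent p) (c : R) : v (fun=> c) = 0.
Proof.
have [i [e ie]] := par_cover p; have [b bP] := tangent_comp v ie.
rewrite bP; last exact: smooth_germ_cst.
transitivity ('D_b (fun=> c : R) e); last exact: derive_cst.
exact/near_eq_derive/(pull_near (fun _ _ => c) (fun=> c) (fun=> c) ie).
Qed.

Lemma tangent_opp p (v : tangent p) f : smooth_germ p f ->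
  v (fun q => - f q) = - v f.
Proof.
move=> fs; rewrite (_ : (fun q => _) = fun q => -1 * f q); last first.
  by apply/funext => q; rewrite mulN1r.
by rewrite tangent_mul ?tangent_cst ?mul0r ?add0r ?mulN1r//; exact: smooth_germ_cst.
Qed.

Lemma tangent_sub p (v : tangent p) f g : smooth_germ p f -> smooth_germ p g ->
  v (fun q => f q - g q) = v f - v g.
Proof. by move=> fs gs; rewrite tangent_add ?tangent_opp//; exact: smooth_germN. Qed.

Lemma tangent_inv p (v : tangent p) f : (forall q, f q != 0) -> smooth_fun f ->
  v (fun q => (f q)^-1) = - v f / f p ^+ 2.
Proof.
move=> f0 fs; have Vs := smooth_funV f0 fs.
have : v (fun q => f q * (f q)^-1) = 0.
  rewrite (_ : (fun q => _) = fun=> 1) ?tangent_cst//.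
  by apply/funext => q; rewrite mulfV.
rewrite (tangent_mul v (fs p) (Vs p)) => /eqP; rewrite addrC addr_eq0 => /eqP E.
by apply: (mulfI (f0 p)); rewrite E; field; exact: f0.
Qed.

Lemma tvalD p (v w : tangent p) f : (v + w) f = v f + w f.
Proof. by []. Qed.
Lemma tvalN p (v : tangent p) f : (- v) f = - v f.
Proof. by []. Qed.
Lemma tvalZ p (a : R) (v : tangent p) f : (a *: v) f = a * v f.
Proof. by []. Qed.
Lemma tval0 p f : (0 : tangent p) f = 0.
Proof. by []. Qed.

End Germs.

(** * The Lie algebra of vector fields *)

Section VectorFields.
Context {R : realType} {m : nat} {N : atlas R m}.
Implicit Types (X Y Z : vfield N) (p : N) (f : N -> R).

Lemma vf_zero_smooth : smooth_vf (fun p : N => 0).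
Proof.
move=> i; exists (fun=> 0) => [j|e p ie f fs]; last by rewrite derive0.
rewrite (_ : (fun=> _) = fun=> 0); first exact: smooth_cst.
by apply/funext => e; rewrite mxE.
Qed.

Lemma vf_add_smooth X Y : smooth_vf (fun p => X p + Y p).
Proof.
move=> i; have [c cs cP] := vfP X i; have [d ds dP] := vfP Y i.
exists (fun e => c e + d e) => [j|e p ie f fs].
  apply: smooth_ext (smoothD _ (cs j) (ds j)); [exact: open_dom| |exact: open_dom].
  by move=> x _; rewrite mxE.
rewrite (deriveD_dir _ _ (smooth_germ_diff ie fs)).
by rewrite -(cP _ _ ie _ fs) -(dP _ _ ie _ fs).
Qed.

Lemma smooth_pull f i : smooth_fun f -> smooth (dom i) (pull (N := N) i f).
Proof.
move=> fs; apply: smooth_local => e /domP[p ie]; exact: (fs p i e ie).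
Qed.

Lemma vf_scale_smooth f X : smooth_fun f -> smooth_vf (fun p => f p *: X p).
Proof.
move=> fs i; have [c cs cP] := vfP X i.
exists (fun e => pull i f e *: c e) => [j|e p ie h hs].
  apply: smooth_ext (smoothM _ (smooth_pull i fs) (cs j));
    [exact: open_dom| |exact: open_dom].
  by move=> x _; rewrite mxE.
rewrite (deriveZ_dir _ _ (smooth_germ_diff ie hs)) (pullE _ ie).
by rewrite -(cP _ _ ie _ hs).
Qed.

Lemma smooth_fun_const (c : R) : smooth_fun (N := N) (fun=> c).
Proof. by move=> p; exact: smooth_germ_cst. Qed.

Definition vf_zero : vfield N := VField vf_zero_smooth.
Definition vf_add X Y : vfield N := VField (vf_add_smooth X Y).
Definition vf_scale f (fs : smooth_fun f) X : vfield N := VField (vf_scale_smooth X fs).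
Definition vf_opp : vfield N -> vfield N := vf_scale (smooth_fun_const (-1)).

HB.instance Definition _ := gen_eqMixin (vfield N).
HB.instance Definition _ := gen_choiceMixin (vfield N).

Lemma vf_addA : associative vf_add.
Proof. by move=> X Y Z; apply: vfieldP => p; exact: addrA. Qed.
Lemma vf_addC : commutative vf_add.
Proof. by move=> X Y; apply: vfieldP => p; exact: addrC. Qed.
Lemma vf_add0 : left_id vf_zero vf_add.
Proof. by move=> X; apply: vfieldP => p; exact: add0r. Qed.
Lemma vf_addN : left_inverse vf_zero vf_opp vf_add.
Proof. by move=> X; apply: vfieldP => p; rewrite /= scaleN1r addNr. Qed.

HB.instance Definition _ :=
  GRing.isZmodule.Build (vfield N) vf_addA vf_addC vf_add0 vf_addN.

Lemma vfD X Y p : (X + Y) p = X p + Y p. Proof. by []. Qed.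
Lemma vfN X p : (- X) p = - X p. Proof. exact: scaleN1r. Qed.
Lemma vfZ f (fs : smooth_fun f) X p : (vf_scale fs X) p = f p *: X p.
Proof. by []. Qed.

Lemma bracketE X Y p f : smooth_germ p f ->
  bracket X Y p f = X p (Y ^~ f) - Y p (X ^~ f).
Proof. by move=> fs; rewrite /= /bracket_val asboolT. Qed.

Lemma vfield_germP X Y : (forall p f, smooth_germ p f -> X p f = Y p f) -> X = Y.
Proof. by move=> XY; apply: vfieldP => p; apply: tangentP => f; exact: XY. Qed.

Lemma bracketC X Y : bracket X Y = - bracket Y X.
Proof.
apply: vfield_germP => p f fs; rewrite vfN tvalN !bracketE//.
by rewrite opprB.
Qed.

Lemma bracketDr X Y Z : bracket X (Y + Z) = bracket X Y + bracket X Z.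
Proof.
apply: vfield_germP => p f fs; rewrite vfD tvalD !bracketE//.
rewrite vfD tvalD [X in X - _](_ : _ = X p (Y ^~ f) + X p (Z ^~ f)); first ring.
by apply: tangent_add; exact: smooth_vf_germ.
Qed.

Lemma bracketDl X Y Z : bracket (X + Y) Z = bracket X Z + bracket Y Z.
Proof. by rewrite bracketC bracketDr opprD -!bracketC. Qed.

Lemma bracket0l X : bracket 0 X = 0.
Proof. by rewrite -(addrK (bracket 0 X) (bracket 0 X)) -bracketDl addr0 subrr. Qed.

Lemma bracketNr X Y : bracket X (- Y) = - bracket X Y.
Proof.
apply/eqP; rewrite -addr_eq0 -bracketDr addNr.
by rewrite -(addrK (bracket X 0) (bracket X 0)) -bracketDr addr0 subrr.
Qed.

Lemma bracketNl X Y : bracket (- X) Y = - bracket X Y.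
Proof. by rewrite bracketC bracketNr -bracketC. Qed.

Lemma bracketZr X Y f (fs : smooth_fun f) :
  bracket X (vf_scale fs Y) = vf_scale fs (bracket X Y) +
    vf_scale (fun p => smooth_vf_germ X (fs p)) Y.
Proof.
apply: vfield_germP => p h hs; rewrite vfD tvalD !vfZ !tvalZ !bracketE//.
rewrite vfZ tvalZ.
rewrite [X in X - _](_ : _ = X p f * Y p h + f p * X p (Y ^~ h)); first ring.
exact: (tangent_mul (X p) (fs p) (smooth_vf_germ Y hs)).
Qed.

Lemma Jacobi X Y Z :
  bracket X (bracket Y Z) = bracket (bracket X Y) Z + bracket Y (bracket X Z).
Proof.
(* Iterated brackets can be expanded only near [p], where the germ stays smooth. *)
have brE (V A B : vfield N) p f : smooth_germ p f ->
    V p (bracket A B ^~ f) = V p (A ^~ (B ^~ f)) - V p (B ^~ (A ^~ f)).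
  move=> fs; have [As Bs] := (smooth_vf_germ A fs, smooth_vf_germ B fs).
  rewrite -tangent_sub; [|exact: smooth_vf_germ..].
  apply: (tangent_germ _ fs) => [||q qs]; first exact: smooth_vf_germ.
    by apply: smooth_germB; exact: smooth_vf_germ.
  exact: bracketE.
apply: vfield_germP => p f fs.
have [Xs [Ys Zs]] := (smooth_vf_germ X fs, (smooth_vf_germ Y fs, smooth_vf_germ Z fs)).
by rewrite vfD tvalD !(bracketE, brE)//; ring.
Qed.

End VectorFields.

(** * Vertical calculus on the slit tangent bundle *)

Section Slit.
Context {R : realType} {n : nat} {M : manifold R n}.
Local Notation TM := (slit_atlas M).
Implicit Types (u q : slit M) (i : mindex M) (e x : 'rV[R]_(n + n)).
Implicit Types (X Y Z : pvfield M) (V W : vfield TM) (h : base M -> R) (f : TM -> R).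

Definition comps i (c : 'rV[R]_(n + n) -> 'rV[R]_n) (Y : pvfield M) :=
  smooth_map (dom (N := TM) i) c /\ forall e u, par TM i e = Some u ->
    is_comp (N := base M) i (lsubmx e) (c e) (Y u).

Lemma ex_comps Y i : exists c, comps i c Y.
Proof. by have [c cs cP] := pvfP Y i; exists c. Qed.

Lemma is_compD i e u b c (v w : tangentM (foot u)) : par TM i e = Some u ->
  is_comp (N := base M) i (lsubmx e) b v -> is_comp (N := base M) i (lsubmx e) c w ->
  is_comp (N := base M) i (lsubmx e) (b + c) (v + w).
Proof.
move=> ie vb wc h hs; rewrite tvalD (vb _ hs) (wc _ hs).
by rewrite (deriveD_dir _ _ (pull_smooth_diff ie hs)).
Qed.

Lemma is_compZ i e u b (a : R) (v : tangentM (foot u)) : par TM i e = Some u ->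
  is_comp (N := base M) i (lsubmx e) b v ->
  is_comp (N := base M) i (lsubmx e) (a *: b) (a *: v).
Proof.
move=> ie vb h hs; rewrite tvalZ (vb _ hs).
by rewrite (deriveZ_dir _ _ (pull_smooth_diff ie hs)).
Qed.

Lemma derive_proj i e u b h : par TM i e = Some u ->
  smooth_germ (N := base M) (foot u) h ->
  'D_b (pull (N := TM) i (h \o @foot R n M)) e =
  'D_(lsubmx b) (pull (N := base M) i h) (lsubmx e).
Proof.
move=> ie hs; pose v := Tangent (dir_tangent b ie).
have vb : is_comp (N := TM) i e b v by move=> f fs; rewrite /= /dir asboolT.
by rewrite -(vb _ (smooth_germ_proj hs)) (rho_comp ie vb hs).
Qed.

(** Being smooth at the foot is an open condition on slit vectors; this makes the
    locality of tangent vectors applicable to functions [q |-> Y q h]. *)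
Lemma germ_foot_open i e u h : par TM i e = Some u ->
  smooth_germ (N := base M) (foot u) h ->
  exists A, [/\ open A, A e, A `<=` dom (N := TM) i,
    smooth A (pull (N := TM) i (h \o @foot R n M)) &
    forall x q, A x -> par TM i x = Some q -> smooth_germ (N := base M) (foot q) h].
Proof.
move=> ie hs; have [A [oA Ae Ad hA nA]] := smooth_germ_open (par_slit_base ie) hs.
have oB : open ((lsubmx : 'rV[R]_(n + n) -> 'rV_n) @^-1` A).
  by apply: open_comp => // x _; exact: continuous_lsubmx.
have oC : open (lsubmx @^-1` A `&` dom (N := TM) i).
  by apply: openI => //; exact: open_dom.
exists (lsubmx @^-1` A `&` dom (N := TM) i); split=> //.
- by split=> //; exact: domS ie.
- apply: smooth_ext (smooth_comp oC _ (smooth_lsubmx _) hA) => //.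
    by move=> x [_ dx]; rewrite /= pull_proj.
  by move=> x [].
- by move=> x q [Ax _] ix; exact: nA (par_slit_base ix).
Qed.

Lemma tangent_foot_germ u (v : tangent (N := TM) u) f g h :
  smooth_germ (N := base M) (foot u) h ->
  smooth_germ (N := TM) u f -> smooth_germ (N := TM) u g ->
  (forall q, smooth_germ (N := base M) (foot q) h -> f q = g q) -> v f = v g.
Proof.
move=> hs fs gs fg; have [i [e ie]] := @par_cover _ _ TM u.
have [A [oA Ae Ad _ nA]] := germ_foot_open ie hs.
apply: tangent_near ie fs gs _; apply: open_near oA Ae _ => x Ax.
have [q iq] := domP (Ad _ Ax); rewrite !(pullE (N := TM) _ iq).
exact/fg/(nA x).
Qed.

Lemma pvf_pull i c Y e u h : comps i c Y -> par TM i e = Some u ->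
  smooth_germ (N := base M) (foot u) h ->
  Y u h = 'D_(row_mx (c e) 0) (pull (N := TM) i (h \o @foot R n M)) e.
Proof.
by move=> [_ cP] ie hs; rewrite (cP _ _ ie _ hs) (derive_proj _ ie hs) row_mxKl.
Qed.

Lemma smooth_map0 m p (A : set 'rV[R]_m) : smooth_map A (fun=> 0 : 'rV[R]_p).
Proof.
move=> j; rewrite (_ : (fun=> _) = fun=> 0); first exact: smooth_cst.
by apply/funext => x; rewrite mxE.
Qed.

Lemma smooth_germ_pvf Y u h : smooth_germ (N := base M) (foot u) h ->
  smooth_germ (N := TM) u (Y ^~ h).
Proof.
move=> hs; have [i [e ie]] := @par_cover _ _ TM u; have [c [cs cP]] := ex_comps Y i.
have [A [oA Ae Ad hA nA]] := germ_foot_open ie hs.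
apply: (smooth_germ_chart (N := TM) ie); exists A; split=> //.
have xis : smooth_map A (fun x => row_mx (c x) (0 : 'rV[R]_n)).
  by apply: smooth_row_mx; [exact: smooth_map_sub cs|exact: smooth_map0].
apply: smooth_ext oA _ (smooth_derive_along oA xis hA) => x Ax.
have [q iq] := domP (Ad _ Ax); rewrite (pullE (N := TM) _ iq).
by rewrite (pvf_pull (conj cs cP) iq)//; exact: nA iq.
Qed.

(** Sections are constructed below from their values on germs; this is what such
    a family of values has to satisfy. *)
Definition functional_comps (w : forall u, (base M -> R) -> R) :=
  forall i, exists2 c : 'rV[R]_(n + n) -> 'rV[R]_n,
    smooth_map (dom (N := TM) i) c & forall e u, par TM i e = Some u -> forall h,
      w u h = if `[< smooth_germ (N := base M) (foot u) h >]
              then 'D_(c e) (pull (N := base M) i h) (lsubmx e) else 0.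

Lemma functional_tangent w (wc : functional_comps w) u :
  w u \in is_tangent (N := base M) (foot u).
Proof.
apply/asboolP => i a ia; have [b ib] := par_slit_row ia.
have [c _ cP] := wc i; exists (c (row_mx a b)) => h.
by rewrite (cP _ _ ib) row_mxKl.
Qed.

Lemma functional_smooth w (wc : functional_comps w) :
  smooth_pvf (fun u => Tangent (functional_tangent wc u)).
Proof.
move=> i; have [c cs cP] := wc i; exists c => // e u ie h hs.
by rewrite /= (cP _ _ ie) asboolT.
Qed.

Definition pvf_of_functional w (wc : functional_comps w) : pvfield M :=
  PVField (functional_smooth wc).

Lemma gamma_is_comp i e u c (w : tangentM (foot u)) : par TM i e = Some u ->
  is_comp (N := base M) i (lsubmx e) c w ->
  is_comp (N := TM) i e (row_mx 0 c) (gamma w).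
Proof.
by move=> ie wc f fs; rewrite /= /gamma_val asboolT//; exact: gamma_comp.
Qed.

Lemma gamma_linear u (a : R) (v w : tangentM (foot u)) :
  gamma (a *: v + w) = a *: gamma v + gamma w.
Proof.
have [i [e ie]] := @par_cover _ _ TM u; apply: tangentP => f fs.
have [b bP] := tangent_comp v (par_slit_base ie).
have [c cP] := tangent_comp w (par_slit_base ie).
rewrite tvalD tvalZ (gamma_is_comp ie (is_compD ie (is_compZ a ie bP) cP) fs).
rewrite (gamma_is_comp ie bP fs) (gamma_is_comp ie cP fs).
have df := smooth_germ_diff ie fs.
rewrite -(deriveZ_dir _ _ df) -(deriveD_dir _ _ df) scale_row_mx add_row_mx.
by rewrite scaler0 addr0.
Qed.

Lemma gamma0 u : gamma (0 : tangentM (foot u)) = 0.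
Proof.
have := gamma_linear (-1) (0 : tangentM (foot u)) 0.
by rewrite scaler0 addr0 scaleN1r addNr.
Qed.

Lemma gammaD u (v w : tangentM (foot u)) : gamma (v + w) = gamma v + gamma w.
Proof. by have := gamma_linear 1 v w; rewrite !scale1r. Qed.

Lemma gammaZ u (a : R) (v : tangentM (foot u)) : gamma (a *: v) = a *: gamma v.
Proof. by have := gamma_linear a v 0; rewrite gamma0 !addr0. Qed.

Lemma rhoE u (v : tangent (N := TM) u) h : smooth_germ (N := base M) (foot u) h ->
  rho v h = v (h \o @foot R n M).
Proof. by move=> hs; rewrite /= /rho_val asboolT. Qed.

Lemma rho_linear u (a : R) (v w : tangent (N := TM) u) :
  rho (a *: v + w) = a *: rho v + rho w.
Proof. by apply: tangentP => h hs; rewrite tvalD tvalZ !rhoE. Qed.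

Lemma rho0 u : rho (0 : tangent (N := TM) u) = 0.
Proof. by apply: tangentP => h hs; rewrite rhoE. Qed.

Lemma rhoD u (v w : tangent (N := TM) u) : rho (v + w) = rho v + rho w.
Proof. by have := rho_linear 1 v w; rewrite !scale1r. Qed.

Lemma rhoZ u (a : R) (v : tangent (N := TM) u) : rho (a *: v) = a *: rho v.
Proof. by have := rho_linear a v 0; rewrite rho0 !addr0. Qed.

Lemma rho_gamma u (w : tangentM (foot u)) : rho (gamma w) = 0.
Proof.
have [i [e ie]] := @par_cover _ _ TM u; apply: tangentP => h hs.
have [c cP] := tangent_comp w (par_slit_base ie).
by rewrite rhoE// (rho_comp ie (gamma_is_comp ie cP) hs) row_mxKl derive0.
Qed.

(** The coefficients of [d/dx^k] in [Y ^~ h] are functions on the base, so a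
    vertical derivative acts on the components of [Y] only. *)
Lemma derive_pvf i c Y e u b h : comps i c Y -> par TM i e = Some u ->
  smooth_germ (N := base M) (foot u) h ->
  'D_(row_mx 0 b) (pull (N := TM) i (Y ^~ h)) e =
  'D_('D_(row_mx 0 b) c e) (pull (N := base M) i h) (lsubmx e).
Proof.
move=> [cs cP] ie hs; have [A [oA Ae Ad hA nA]] := germ_foot_open ie hs.
pose F := pull (N := TM) i (h \o @foot R n M).
pose xi := fun x => row_mx (c x) (0 : 'rV[R]_n).
have xis : smooth_map A xi.
  by apply: smooth_row_mx; [exact: smooth_map_sub cs|exact: smooth_map0].
have FE : \forall x \near e, pull (N := TM) i (Y ^~ h) x = 'D_(xi x) F x.
  apply: open_near oA Ae _ => x Ax; have [q iq] := domP (Ad _ Ax).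
  rewrite (pullE (N := TM) _ iq) (pvf_pull (conj cs cP) iq)//; exact: nA iq.
rewrite (near_eq_derive _ FE) (derive_derive_along _ oA Ae hA xis).
have F0 : \forall x \near e, 'D_(row_mx 0 b) F x = 0.
  apply: open_near oA Ae _ => x Ax; have [q iq] := domP (Ad _ Ax).
  by rewrite (derive_proj _ iq (nA _ _ Ax iq)) row_mxKl derive0.
have -> : 'D_(xi e) ('D_(row_mx 0 b) F) e = 0.
  transitivity ('D_(xi e) (fun=> 0 : R) e); first exact: near_eq_derive.
  exact: derive_cst.
rewrite addr0 (derive_proj _ ie hs).
suff -> : lsubmx ('D_(row_mx 0 b) xi e) = 'D_(row_mx 0 b) c e by [].
apply/rowP => j.
rewrite mxE (derive_coord _ _ (smooth_map_diff xis Ae)).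
rewrite (derive_coord _ _ (smooth_map_diff cs (domS ie))).
rewrite (_ : (fun x => xi x 0 (lshift n j)) = fun x => c x 0 j)//.
by apply/funext => x; rewrite /xi row_mxEl.
Qed.

(** The derivative of the section [Y] along the vertical field [gamma X] makes
    sense without a connection, since [pi^{-1}(TM)] is trivial along each fibre
    of the slit bundle. *)
Definition vder_val X Y u h : R :=
  if `[< smooth_germ (N := base M) (foot u) h >] then gamma (X u) (Y ^~ h) else 0.

Lemma vder_functional X Y : functional_comps (vder_val X Y).
Proof.
move=> i; have [[c [cs cP]] [d [ds dP]]] := (ex_comps X i, ex_comps Y i).
have xis : smooth_map (dom (N := TM) i) (fun x => row_mx (0 : 'rV[R]_n) (c x)).
  by apply: smooth_row_mx => //; exact: smooth_map0.
exists (fun x => 'D_(row_mx 0 (c x)) d x) => [j|e u ie h].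
  have o := open_dom (N := TM) (i := i).
  apply: smooth_ext o _ (smooth_derive_along o xis (ds j)) => x Dx.
  by rewrite (derive_coord _ _ (smooth_map_diff ds Dx)).
rewrite /vder_val; case: asboolP => // hs.
rewrite (gamma_is_comp ie (cP _ _ ie) (smooth_germ_pvf Y hs)).
exact: (derive_pvf (c e) (conj ds dP : comps i d Y) ie hs).
Qed.

Definition vder X Y : pvfield M := pvf_of_functional (vder_functional X Y).

Lemma vderE X Y u h : smooth_germ (N := base M) (foot u) h ->
  vder X Y u h = gamma (X u) (Y ^~ h).
Proof. by move=> hs; rewrite /= /vder_val asboolT. Qed.

Lemma vder_comps X Y i c d : comps i c X -> comps i d Y ->
  forall e u, par TM i e = Some u ->
  is_comp (N := base M) i (lsubmx e) ('D_(row_mx 0 (c e)) d e) (vder X Y u).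
Proof.
move=> [_ cP] dY e u ie h hs; rewrite vderE//.
by rewrite (gamma_is_comp ie (cP _ _ ie) (smooth_germ_pvf Y hs)) (derive_pvf _ dY ie hs).
Qed.

(** The correction by [vder X Y] accounts for the derivative of the components of
    [Y]; what remains is a second derivative in constant directions, symmetric in
    [X] and [Y] by Schwarz's theorem. *)
Lemma gamma_gamma X Y u f i c d e : comps i c X -> comps i d Y ->
  par TM i e = Some u -> smooth_germ (N := TM) u f ->
  gamma_vf X u (gamma_vf Y ^~ f) = gamma_vf (vder X Y) u f +
    'D_(row_mx 0 (d e)) ('D_(row_mx 0 (c e)) (pull (N := TM) i f)) e.
Proof.
move=> cX dY ie fs; have [A [oA Ae Ad fA nA]] := smooth_germ_open ie fs.
have [ds dP] := dY; have [cs cP] := cX.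
pose F := pull (N := TM) i f; pose xi := fun x => row_mx (0 : 'rV[R]_n) (d x).
have xis : smooth_map A xi.
  by apply: smooth_row_mx; [exact: smooth_map0|exact: smooth_map_sub ds].
rewrite (gamma_is_comp ie (cP _ _ ie) (smooth_vf_germ _ fs)).
have FE : \forall x \near e, pull (N := TM) i (gamma_vf Y ^~ f) x = 'D_(xi x) F x.
  apply: open_near oA Ae _ => x Ax; have [q iq] := domP (Ad _ Ax).
  rewrite (pullE (N := TM) _ iq) (gamma_is_comp iq (dP _ _ iq))//; exact: nA iq.
rewrite (near_eq_derive _ FE) [LHS](derive_derive_along (row_mx 0 (c e)) oA Ae fA xis).
rewrite (gamma_is_comp ie (vder_comps cX dY ie) fs).
suff -> : 'D_(row_mx 0 (c e)) xi e = row_mx 0 ('D_(row_mx 0 (c e)) d e) by [].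
apply/rowP => j; rewrite (derive_coord _ _ (smooth_map_diff xis Ae)).
case: (split_ordP j) => k ->; rewrite ?row_mxEl ?row_mxEr ?mxE.
  rewrite (_ : (fun x => _) = fun=> 0) ?derive_cst//.
  by apply/funext => x; rewrite row_mxEl mxE.
rewrite (derive_coord _ _ (smooth_map_diff ds (domS ie))).
rewrite (_ : (fun x => row_mx _ (d x) 0 _) = fun x => d x 0 k)//.
by apply/funext => x; rewrite row_mxEr.
Qed.

Lemma bracket_gamma X Y :
  bracket (gamma_vf X) (gamma_vf Y) = gamma_vf (vder X Y - vder Y X).
Proof.
apply: vfield_germP => u f fs; rewrite bracketE//.
have [i [e ie]] := @par_cover _ _ TM u.
have [[c cX] [d dY]] := (ex_comps X i, ex_comps Y i).
have [A [oA Ae _ fA _]] := smooth_germ_open ie fs.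
have E1 := gamma_gamma cX dY ie fs; have E2 := gamma_gamma dY cX ie fs.
have S := Schwarz (row_mx 0 (c e)) (row_mx 0 (d e)) oA Ae fA.
have -> : gamma_vf (vder X Y - vder Y X) u =
    gamma_vf (vder X Y) u - gamma_vf (vder Y X) u.
  by rewrite /= gammaD gammaZ scaleN1r.
rewrite tvalD tvalN.
have key (a b a' b' s t : R) : a = a' + s -> b = b' + t -> t = s ->
    a - b = a' - b'.
  by move=> -> -> ->; ring.
exact: key E1 E2 (esym S).
Qed.

Lemma rho_bracket X V : rho_vf (bracket (gamma_vf X) V) = vder X (rho_vf V).
Proof.
apply: pvfieldP => u; apply: tangentP => h hs.
rewrite vderE// -[LHS]/(rho (bracket (gamma_vf X) V u) h) rhoE//.
have hs' := smooth_germ_proj hs; rewrite bracketE//.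
have -> : V u (gamma_vf X ^~ (h \o @foot R n M)) = 0.
  rewrite -[RHS](tangent_cst (V u) 0).
  apply: (tangent_foot_germ _ hs) => [||q qs]; first exact: smooth_vf_germ.
    exact: smooth_germ_cst.
  by rewrite -(rhoE (gamma (X q)) qs) rho_gamma.
rewrite subr0; apply: (tangent_foot_germ _ hs) => [||q qs].
- exact: smooth_vf_germ.
- exact: smooth_germ_pvf.
- by rewrite -[RHS]/(rho (V q) h) rhoE.
Qed.

Lemma eta_comps i : comps i rsubmx (eta M).
Proof.
split; first exact: smooth_rsubmx.
by move=> e u ie; have [_ _] := (par_slitP _ _ _).1 ie.
Qed.

Lemma derive_rsubmx e (b : 'rV[R]_n) :
  'D_(row_mx 0 b) (rsubmx : 'rV[R]_(n + n) -> 'rV_n) e = b.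
Proof.
rewrite derive_linear; last by move=> x; exact: continuous_rsubmx.
exact: row_mxKr.
Qed.

Lemma vder_eta X : vder X (eta M) = X.
Proof.
apply: pvfieldP => u; have [i [e ie]] := @par_cover _ _ TM u.
have [c cX] := ex_comps X i; apply: tangentP => h hs.
by rewrite (vder_comps cX (eta_comps i) ie hs) derive_rsubmx (cX.2 _ _ ie _ hs).
Qed.

Lemma comp_eq0 i e u b : par TM i e = Some u ->
  is_comp (N := base M) i (lsubmx e) b (0 : tangentM (foot u)) -> b = 0.
Proof.
move=> ie b0; have [te pe _] := (par_slitP _ _ _).1 ie.
apply/rowP => k; have fs := coord_smooth k te.
rewrite -(cvec_coord b k te) (cvec_comp _ te fs) mxE; rewrite pe in fs.
by rewrite -(b0 _ fs).
Qed.

(** The value of [X] on [h] is recovered by applying [V] to the fibrewise linear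
    function [q |-> vec q h]. *)
Lemma vertical_gamma V : rho_vf V = 0 -> exists X, V = gamma_vf X.
Proof.
move=> V0; pose w u h := if `[< smooth_germ (N := base M) (foot u) h >]
  then V u (eta M ^~ h) else 0.
have xi0 i (xi : 'rV[R]_(n + n) -> 'rV[R]_(n + n)) :
    (forall e p, par TM i e = Some p -> is_comp (N := TM) i e (xi e) (V p)) ->
    forall e u, par TM i e = Some u -> xi e = row_mx 0 (rsubmx (xi e)).
  move=> xiP e u ie; rewrite -[LHS]hsubmxK; congr row_mx.
  apply: (comp_eq0 ie) => h hs.
  by rewrite -(rho_comp ie (xiP _ _ ie) hs) -rhoE// -[rho (V u)]/(rho_vf V u) V0.
have wc : functional_comps w.
  move=> i; have [xi xis xiP] := vfP V i.
  exists (rsubmx \o xi) => [j|e u ie h].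
    rewrite (_ : (fun x => _) = fun x => xi x 0 (rshift n j)); first exact: xis.
    by apply/funext => x; rewrite /= mxE.
  rewrite /w; case: asboolP => // hs.
  rewrite (xiP _ _ ie _ (smooth_germ_pvf (eta M) hs)) (xi0 _ _ xiP _ _ ie).
  by rewrite (derive_pvf _ (eta_comps i) ie hs) derive_rsubmx.
exists (pvf_of_functional wc); apply: vfield_germP => u f fs.
have [i [e ie]] := @par_cover _ _ TM u; have [xi xis xiP] := vfP V i.
rewrite (xiP _ _ ie _ fs) (xi0 _ _ xiP _ _ ie).
rewrite [RHS](gamma_is_comp (c := rsubmx (xi e)) ie)// => h hs /=.
rewrite /w asboolT// (xiP _ _ ie _ (smooth_germ_pvf (eta M) hs)).
rewrite {1}(xi0 _ _ xiP _ _ ie) (derive_pvf _ (eta_comps i) ie hs).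
by rewrite derive_rsubmx.
Qed.

End Slit.

(** * The fibre metric *)

(** The fibre metric as an opaque operation, never to be unfolded to the
    derivatives that define it once its bilinearity is known. *)
HB.lock Definition fibre_metric {R : realType} {n : nat} {M : manifold R n}
  (L : slit M -> R) (u : slit M) (v w : tangentM (foot u)) : R := fmetric L v w.

Section Metric.
Context {R : realType} {n : nat} {M : manifold R n}.
Local Notation TM := (slit_atlas M).
Implicit Types (u q : slit M) (i : mindex M) (e x : 'rV[R]_(n + n)).
Implicit Types (X Y Z : pvfield M) (V W : vfield TM) (h : base M -> R) (f : TM -> R).

Lemma pvf_germP X Y : (forall u h, smooth_germ (N := base M) (foot u) h ->
  X u h = Y u h) -> X = Y.
Proof. by move=> XY; apply: pvfieldP => u; apply: tangentP => h; exact: XY. Qed.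

Lemma pvfD X Y u : (X + Y) u = X u + Y u. Proof. by []. Qed.
Lemma pvfN X u : (- X) u = - X u. Proof. exact: scaleN1r. Qed.
Lemma pvfB X Y u : (X - Y) u = X u - Y u. Proof. by rewrite pvfD pvfN. Qed.
Lemma pvf0 u : (0 : pvfield M) u = 0. Proof. by []. Qed.
Lemma pvfZ f (fs : smooth_fun f) X u : (pvf_scale fs X) u = f u *: X u.
Proof. by []. Qed.

Lemma gamma_vfD X Y : gamma_vf (X + Y) = gamma_vf X + gamma_vf Y.
Proof. by apply: vfieldP => u; exact: gammaD. Qed.

Lemma gamma_vfN X : gamma_vf (- X) = - gamma_vf X.
Proof. by apply: vfieldP => u; exact: gammaZ. Qed.

Lemma gamma_vfZ f (fs : smooth_fun f) X :
  gamma_vf (pvf_scale fs X) = vf_scale fs (gamma_vf X).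
Proof. by apply: vfieldP => u; exact: gammaZ. Qed.

Lemma rho_vfD V W : rho_vf (V + W) = rho_vf V + rho_vf W.
Proof. by apply: pvfieldP => u; exact: rhoD. Qed.

Lemma rho_vfN V : rho_vf (- V) = - rho_vf V.
Proof. by apply: pvfieldP => u; exact: rhoZ. Qed.

Lemma rho_gamma_vf X : rho_vf (gamma_vf X) = 0.
Proof. by apply: pvfieldP => u; exact: rho_gamma. Qed.

Lemma vderDl X Y Z : vder (X + Y) Z = vder X Z + vder Y Z.
Proof.
by apply: pvf_germP => u h hs; rewrite pvfD tvalD !vderE// pvfD gammaD tvalD.
Qed.

Lemma vderNl X Y : vder (- X) Y = - vder X Y.
Proof.
apply: pvf_germP => u h hs; rewrite pvfN tvalN !vderE// pvfN -scaleN1r gammaZ.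
by rewrite tvalZ mulN1r.
Qed.

Lemma vderDr X Y Z : vder X (Y + Z) = vder X Y + vder X Z.
Proof.
apply: pvf_germP => u h hs; rewrite pvfD tvalD !vderE//.
by apply: tangent_add; exact: smooth_germ_pvf.
Qed.

Lemma vderZr f (fs : smooth_fun f) X Y : vder X (pvf_scale fs Y) =
  pvf_scale fs (vder X Y) +
  pvf_scale (fun u => smooth_vf_germ (gamma_vf X) (fs u)) Y.
Proof.
apply: pvf_germP => u h hs; rewrite pvfD tvalD !pvfZ !tvalZ !vderE//.
rewrite [LHS](_ : _ = gamma (X u) f * Y u h + f u * gamma (X u) (Y ^~ h)).
  exact: addrC.
exact: (tangent_mul (gamma (X u)) (fs u) (smooth_germ_pvf Y hs)).
Qed.

Lemma vder0l X : vder 0 X = 0.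
Proof. by rewrite -(addrK (vder 0 X) (vder 0 X)) -vderDl addr0 subrr. Qed.

Lemma vder0r X : vder X 0 = 0.
Proof. by rewrite -(addrK (vder X 0) (vder X 0)) -vderDr addr0 subrr. Qed.

Lemma vderNr X Y : vder X (- Y) = - vder X Y.
Proof.
apply/eqP; rewrite -addr_eq0 -vderDr addNr.
by rewrite -(addrK (vder X 0) (vder X 0)) -vderDr addr0 subrr.
Qed.

(** On the functions [Z ^~ h] the operator [vder X] is the derivation [gamma X], so
    flatness is [bracket_gamma]. *)
Lemma vder_flat X Y Z :
  vder X (vder Y Z) - vder Y (vder X Z) = vder (vder X Y - vder Y X) Z.
Proof.
apply: pvf_germP => u h hs; rewrite pvfB tvalD tvalN !vderE//.
have key (A B : pvfield M) : gamma (A u) (vder B Z ^~ h) =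
    gamma_vf A u (gamma_vf B ^~ (Z ^~ h)).
  apply: (tangent_foot_germ _ hs) => [||q qs]; first exact: smooth_germ_pvf.
    exact/smooth_vf_germ/smooth_germ_pvf.
  by rewrite vderE.
rewrite !key -bracketE; last exact: smooth_germ_pvf.
by rewrite bracket_gamma.
Qed.

Lemma ext_pull i e u c (w : tangentM (foot u)) f : par TM i e = Some u ->
  is_comp (N := base M) i (lsubmx e) c w ->
  ext f (vec u + w) = pull (N := TM) i f (e + row_mx 0 c).
Proof.
move=> ie wc; rewrite /ext /pull; congr oapp.
have [te pe ec] := (par_slitP _ _ _).1 ie.
have -> : e + row_mx 0 c = row_mx (lsubmx e) (rsubmx e + c).
  by rewrite -[e in LHS]hsubmxK add_row_mx addr0.
rewrite /= /par_slit row_mxKl row_mxKr asboolT//; apply: mk_slit_eq => // h hs.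
have ps : smooth_germ (N := base M) (param (mchart i) (lsubmx e)) h by rewrite pe.
rewrite (cvec_comp _ te ps) tvalD.
have dh := pull_smooth_diff ie hs.
by rewrite (deriveD_dir _ _ dh) (ec _ hs) (wc _ hs).
Qed.

Section Energy.
Variable L : slit M -> R.
Local Notation L2 := (fun u => L u ^+ 2).
Local Notation g := (fibre_metric L _).

Lemma fibre_metricE u (v w : tangentM (foot u)) : fmetric L v w = g v w.
Proof. by rewrite fibre_metric.unlock. Qed.

(** A second derivative along constant directions of the fibre; bilinearity and
    symmetry of the metric are read off from this. *)
Lemma fmetric_comp i e u b c (v w : tangentM (foot u)) : par TM i e = Some u ->
  smooth_germ (N := TM) u L2 ->
  is_comp (N := base M) i (lsubmx e) b v -> is_comp (N := base M) i (lsubmx e) c w ->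
  2 * g v w =
    'D_(row_mx 0 b) ('D_(row_mx 0 c) (pull (N := TM) i L2)) e.
Proof.
move=> ie Ls vb wc; rewrite fibre_metric.unlock [LHS]mulVKf; last by rewrite pnatr_eq0.
have [A [oA Ae Ad LA nA]] := smooth_germ_open ie Ls.
set F := pull _ _; set b' := row_mx 0 b; set c' := row_mx 0 c.
have dF := smooth_diff (smooth_derive c' LA) Ae.
rewrite -(derive_line b' dF); apply: near_eq_derive.
have As : \forall s \near (0 : R), A (e + s *: b').
  have cl : {for (0 : R), continuous (fun s : R => e + s *: b')}.
    apply: continuousD; first exact: cst_continuous.
    exact: scalel_continuous.
  apply: cl; rewrite scale0r addr0; exact: open_nbhs_nbhs.
apply: filterS As => s As.
rewrite -(derive_line c' (smooth_diff LA As)).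
congr (derive _ (0 : R) (1 : R)); apply/funext => t.
rewrite -addrA (ext_pull _ ie (is_compD ie (is_compZ s ie vb) (is_compZ t ie wc))).
rewrite -/F; congr F; rewrite -addrA; congr (_ + _).
by rewrite /b' /c' !scale_row_mx !scaler0 add_row_mx addr0.
Qed.

Hypothesis Ls : smooth_fun (N := TM) L2.
Arguments Ls : clear implicits.

Lemma fmetricC u (v w : tangentM (foot u)) : g v w = g w v.
Proof.
have [i [e ie]] := @par_cover _ _ TM u.
have [b bP] := tangent_comp v (par_slit_base ie).
have [c cP] := tangent_comp w (par_slit_base ie).
have [A [oA Ae _ LA _]] := smooth_germ_open ie (Ls u).
have E := fmetric_comp ie (Ls u) bP cP; have E' := fmetric_comp ie (Ls u) cP bP.
have S := Schwarz (row_mx 0 c) (row_mx 0 b) oA Ae LA.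
have two0 : (2 : R) != 0 by rewrite pnatr_eq0.
by apply: (mulfI two0); apply: etrans E (etrans S (esym E')).
Qed.

Lemma fmetric_linear u (a : R) (v v' w : tangentM (foot u)) :
  g (a *: v + v') w = a * g v w + g v' w.
Proof.
have [i [e ie]] := @par_cover _ _ TM u.
have [b bP] := tangent_comp v (par_slit_base ie).
have [b' bP'] := tangent_comp v' (par_slit_base ie).
have [c cP] := tangent_comp w (par_slit_base ie).
have [A [oA Ae _ LA _]] := smooth_germ_open ie (Ls u).
have E := fmetric_comp ie (Ls u) (is_compD ie (is_compZ a ie bP) bP') cP.
have E1 := fmetric_comp ie (Ls u) bP cP; have E2 := fmetric_comp ie (Ls u) bP' cP.
have dF := smooth_diff (smooth_derive (row_mx 0 c) LA) Ae.
have rE : row_mx 0 (a *: b + b') = a *: row_mx 0 b + row_mx (0 : 'rV[R]_n) b'.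
  by rewrite scale_row_mx add_row_mx scaler0 addr0.
rewrite rE (deriveD_dir _ _ dF) (deriveZ_dir _ _ dF) in E.
have two0 : (2 : R) != 0 by rewrite pnatr_eq0.
apply: (mulfI two0); have key (x y z s t : R) : x = a * s + t -> 2 * y = s ->
    2 * z = t -> x = 2 * (a * y + z) by move=> -> <- <-; ring.
exact: key E E1 E2.
Qed.

Lemma fmetric0l u (w : tangentM (foot u)) : g 0 w = 0.
Proof.
have := fmetric_linear (-1) (0 : tangentM (foot u)) 0 w.
by rewrite scaler0 addr0 mulN1r addNr.
Qed.

Lemma fmetricDl u (v v' w : tangentM (foot u)) : g (v + v') w = g v w + g v' w.
Proof. by have := fmetric_linear 1 v v' w; rewrite scale1r mul1r. Qed.

Lemma fmetricZl u (a : R) (v w : tangentM (foot u)) : g (a *: v) w = a * g v w.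
Proof. by have := fmetric_linear a v 0 w; rewrite fmetric0l !addr0. Qed.

Lemma fmetricNl u (v w : tangentM (foot u)) : g (- v) w = - g v w.
Proof. by rewrite -scaleN1r fmetricZl mulN1r. Qed.

Lemma fmetricDr u (v w w' : tangentM (foot u)) : g v (w + w') = g v w + g v w'.
Proof. by rewrite !(fmetricC v) fmetricDl. Qed.

Lemma fmetricZr u (a : R) (v w : tangentM (foot u)) : g v (a *: w) = a * g v w.
Proof. by rewrite !(fmetricC v) fmetricZl. Qed.

Lemma fmetricNr u (v w : tangentM (foot u)) : g v (- w) = - g v w.
Proof. by rewrite !(fmetricC v) fmetricNl. Qed.

Lemma fmetric0r u (v : tangentM (foot u)) : g v 0 = 0.
Proof. by rewrite fmetricC fmetric0l. Qed.

(** The link between the metric and the vertical calculus: from here on no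
    coordinates are needed. *)
Lemma fmetric_hessian X Y u : 2 * g (X u) (Y u) =
  gamma_vf X u (gamma_vf Y ^~ L2) - gamma_vf (vder X Y) u L2.
Proof.
have [i [e ie]] := @par_cover _ _ TM u.
have [[c cX] [d dY]] := (ex_comps X i, ex_comps Y i).
have E := gamma_gamma cX dY ie (Ls u).
have H := fmetric_comp ie (Ls u) (dY.2 _ _ ie) (cX.2 _ _ ie).
rewrite fmetricC; have key (a b s t : R) : t = s -> a = b + s -> t = a - b.
  by move=> -> ->; ring.
exact: key H E.
Qed.

Lemma smooth_fmetric X Y : smooth_fun (N := TM) (fun u => g (X u) (Y u)).
Proof.
move=> u; rewrite (_ : (fun u => _) = fun u => 2^-1 *
    (gamma_vf X u (gamma_vf Y ^~ L2) - gamma_vf (vder X Y) u L2)).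
  apply: smooth_germM; first exact: smooth_germ_cst.
  have L2s := Ls u; apply: smooth_germB; last exact: smooth_vf_germ.
  by do 2! apply: smooth_vf_germ.
by apply/funext => q; rewrite -fmetric_hessian mulrA mulVf ?mul1r ?pnatr_eq0.
Qed.

End Energy.
End Metric.

(** * Connections on the pulled-back bundle *)

(** Turns derivatives and scalar products into variables: decision procedures
    would otherwise unfold them when they compare atoms. *)
Ltac real_atoms := repeat match goal with
  | |- context [@Defs.tval ?R ?m ?N ?p ?v ?f] =>
      generalize (@Defs.tval R m N p v f); intro
  | |- context [@fibre_metric ?R ?n ?M ?L ?u ?v ?w] =>
      generalize (@fibre_metric R n M L u v w); intro
  end.

(** Proves an identity in the abelian group of sections by evaluating both sides
    on a germ, where it becomes an identity between real numbers. *)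
Ltac pvf_ring := apply: pvf_germP => ? ? _;
  rewrite ?(pvfD, pvfN, pvf0, tvalD, tvalN, tval0); real_atoms; ring.

(** The (h)hv-torsion as an opaque operation: it is a sum of sections, and has
    to be told apart from the sums it occurs in. *)
HB.lock Definition cartan_tensor {R : realType} {n : nat} {M : manifold R n}
  (D : regular_connection M) (X Y : pvfield M) : pvfield M := hv_torsion D X Y.

(** Opaque for the same reason. *)
HB.lock Definition berwald_conn {R : realType} {n : nat} {M : manifold R n}
  (D : regular_connection M) (V : vfield (slit_atlas M)) (Y : pvfield M) :
  pvfield M := berwald D V Y.

Section Connections.
Context {R : realType} {n : nat} {M : manifold R n}.
Local Notation TM := (slit_atlas M).
Implicit Types (X Y Z : pvfield M) (V W : vfield TM) (f : TM -> R).

Section Connection.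
Variable D : connection M.

Lemma covDl V W Y : cov D (V + W) Y = cov D V Y + cov D W Y.
Proof.
by apply: pvfieldP => u; have := conn_linear D 1 (V u) (W u) Y; rewrite !scale1r.
Qed.

Lemma conn0 u Y : conn D (0 : tangent (N := TM) u) Y = 0.
Proof.
have := conn_linear D (-1) (0 : tangent (N := TM) u) 0 Y.
by rewrite scaler0 addr0 scaleN1r addNr.
Qed.

Lemma covZl f (fs : smooth_fun f) V Y :
  cov D (vf_scale fs V) Y = pvf_scale fs (cov D V Y).
Proof.
apply: pvfieldP => u; have := conn_linear D (f u) (V u) 0 Y.
by rewrite conn0 !addr0.
Qed.

Lemma cov0l Y : cov D 0 Y = 0.
Proof. by apply: pvfieldP => u; exact: conn0. Qed.

Lemma covNl V Y : cov D (- V) Y = - cov D V Y.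
Proof. by apply/eqP; rewrite -addr_eq0 -covDl addNr cov0l. Qed.

Lemma covDr V Y Z : cov D V (Y + Z) = cov D V Y + cov D V Z.
Proof. by apply: pvfieldP => u; exact: conn_add. Qed.

Lemma cov0r V : cov D V 0 = 0.
Proof. by rewrite -(addrK (cov D V 0) (cov D V 0)) -covDr addr0 subrr. Qed.

Lemma covNr V Y : cov D V (- Y) = - cov D V Y.
Proof. by apply/eqP; rewrite -addr_eq0 -covDr addNr cov0r. Qed.

Lemma torsionC V W : torsion D V W = - torsion D W V.
Proof. by rewrite /torsion (bracketC W V) rho_vfN; pvf_ring. Qed.

Lemma torsionDl V V' W : torsion D (V + V') W = torsion D V W + torsion D V' W.
Proof. by rewrite /torsion bracketDl covDl !rho_vfD covDr; pvf_ring. Qed.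

Lemma torsionDr V W W' : torsion D V (W + W') = torsion D V W + torsion D V W'.
Proof. by rewrite torsionC torsionDl opprD -!(torsionC V). Qed.

End Connection.

Section Regular.
Variable D : regular_connection M.

Lemma conn_mapD V W : conn_map D (V + W) = conn_map D V + conn_map D W.
Proof. exact: covDl. Qed.

Lemma conn_mapN V : conn_map D (- V) = - conn_map D V.
Proof. exact: covNl. Qed.

Lemma conn_mapZ f (fs : smooth_fun f) V :
  conn_map D (vf_scale fs V) = pvf_scale fs (conn_map D V).
Proof. exact: covZl. Qed.

Lemma vf_eq V W : rho_vf V = rho_vf W -> conn_map D V = conn_map D W -> V = W.
Proof.
move=> r k; apply/eqP; rewrite -subr_eq0; apply/eqP/vfieldP => u.
apply: (rconn_regular D u).1.
  by rewrite -[LHS]/(rho_vf (V - W) u) rho_vfD rho_vfN r subrr.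
by rewrite -[LHS]/(conn_map D (V - W) u) conn_mapD conn_mapN k subrr.
Qed.

Lemma hmapD X Y : hmap D (X + Y) = hmap D X + hmap D Y.
Proof. by apply: vf_eq; rewrite ?rho_vfD ?conn_mapD ?hmap_rho ?hmap_ker ?addr0. Qed.

Lemma hmap0 : hmap D 0 = 0.
Proof. by rewrite -(addrK (hmap D 0) (hmap D 0)) -hmapD addr0 subrr. Qed.

Lemma hmapN X : hmap D (- X) = - hmap D X.
Proof. by apply/eqP; rewrite -addr_eq0 -hmapD addNr hmap0. Qed.

Lemma cartan_tensorE X Y : cartan_tensor D X Y = cov D (gamma_vf X) Y - vder X Y.
Proof.
rewrite cartan_tensor.unlock /hv_torsion /torsion rho_bracket rho_gamma_vf.
by rewrite hmap_rho cov0r subr0.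
Qed.

Lemma cartan_tensor0r X : cartan_tensor D X 0 = 0.
Proof. by rewrite cartan_tensorE cov0r vder0r subr0. Qed.

Lemma cartan_tensorNr X Y : cartan_tensor D X (- Y) = - cartan_tensor D X Y.
Proof. by rewrite !cartan_tensorE covNr vderNr opprD. Qed.

Lemma cartan_tensor_torsion X Y : cartan_tensor D X Y = hv_torsion D X Y.
Proof. by rewrite cartan_tensor.unlock. Qed.

Lemma cov_gamma X Y : cov D (gamma_vf X) Y = vder X Y + cartan_tensor D X Y.
Proof. by rewrite cartan_tensorE addrC subrK. Qed.

End Regular.

(** The geometry of a Finsler metric depends on its energy only.  This form is the
    convenient one for the changed metric, which is given by its square.
    Homogeneity enters as Euler's identity, and definiteness on sections only, so
    that vectors need not be extended to sections. *)
Definition finsler_energy (L : slit M -> R) :=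
  [/\ smooth_fun (N := TM) (fun u => L u ^+ 2),
      forall u, gamma (vec u) (fun u => L u ^+ 2) = 2 * L u ^+ 2 &
      forall (X : pvfield M) u, X u != 0 -> 0 < fibre_metric L u (X u) (X u)].

Definition cartan_pair (L : slit M -> R) (D : regular_connection M) :=
  finsler_energy L /\ cartan L D.

(** Euler's identity is homogeneity, differentiated at the scale 1. *)
Lemma finsler_finsler_energy L : finsler L -> finsler_energy L.
Proof.
move=> [Ls L0 Lh gpos]; have L2s : smooth_fun (N := TM) (fun u => L u ^+ 2).
  by move=> u; exact: smooth_germM.
split=> // [u|X u v0]; last by rewrite -fibre_metricE; exact: gpos.
rewrite /= /gamma_val asboolT; last exact: L2s.
have E : \forall t \near (0 : R),
    ext (fun u => L u ^+ 2) (vec u + t *: vec u) = (1 + t) ^+ 2 * L u ^+ 2.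
  near=> t; have t1 : 0 < 1 + t.
    by rewrite -ltrBlDl sub0r; near: t; apply: lt_nbhsr; rewrite oppr_lt0 ltr01.
  rewrite -exprMn -(Lh _ _ t1) scalerDl scale1r /ext.
  by case: (mk_slit _) => //=; rewrite expr0n.
rewrite (near_eq_derive _ E).
have [] : is_derive (0 : R) 1 (fun t : R => (1 + t) ^+ 2 * L u ^+ 2) (2 * L u ^+ 2).
  apply: is_derive_eq; rewrite /GRing.scale /=.
  ring.
by [].
Unshelve. all: by end_near. Qed.

End Connections.

(** * The Cartan and Berwald connections of a Finsler energy *)

Section Cartan.
Context {R : realType} {n : nat} {M : manifold R n}.
Local Notation TM := (slit_atlas M).
Implicit Types (X Y Z U : pvfield M) (V W : vfield TM) (f : TM -> R) (u : slit M).
Variables (L : slit M -> R) (D : regular_connection M).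
Hypothesis LD : cartan_pair L D.
Let EL := proj1 LD.
Let CD := proj2 LD.

Local Notation L2 := (fun u : slit M => L u ^+ 2).
Local Notation g := (fibre_metric L _).
Local Notation b := (hmap D).
Local Notation K := (conn_map D).
Local Notation T := (cartan_tensor D).
Local Notation nab := (cov D).
Local Notation eta := (eta M).

Lemma energy_smooth : smooth_fun (N := TM) L2. Proof. by case: EL. Qed.
Let Ls := energy_smooth.

Lemma energy_euler u : gamma_vf eta u L2 = 2 * L u ^+ 2.
Proof. by case: EL. Qed.

Lemma fmetric_inj X Y : (forall Z u, g (X u) (Z u) = g (Y u) (Z u)) -> X = Y.
Proof.
case: EL => _ _ gpos XY; apply/eqP; rewrite -subr_eq0; apply/eqP/pvfieldP => u.
apply/eqP/negP => /negP /gpos; rewrite {1}pvfB (fmetricDl Ls) (fmetricNl Ls).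
by rewrite XY subrr ltxx.
Qed.

Lemma metricDl X Y Z u : g ((X + Y) u) (Z u) = g (X u) (Z u) + g (Y u) (Z u).
Proof. exact: (fmetricDl Ls). Qed.
Lemma metricNl X Z u : g ((- X) u) (Z u) = - g (X u) (Z u).
Proof. by rewrite pvfN; exact: (fmetricNl Ls). Qed.
Lemma metricDr X Y Z u : g (Z u) ((X + Y) u) = g (Z u) (X u) + g (Z u) (Y u).
Proof. exact: (fmetricDr Ls). Qed.
Lemma metricNr X Z u : g (Z u) ((- X) u) = - g (Z u) (X u).
Proof. by rewrite pvfN; exact: (fmetricNr Ls). Qed.
Lemma metric0l Z u : g ((0 : pvfield M) u) (Z u) = 0.
Proof. exact: (fmetric0l Ls). Qed.
Lemma metric0r Z u : g (Z u) ((0 : pvfield M) u) = 0.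
Proof. exact: (fmetric0r Ls). Qed.
Lemma metricC X Y u : g (X u) (Y u) = g (Y u) (X u).
Proof. exact: (fmetricC Ls). Qed.
Let metricE := (metricDl, metricNl, metricDr, metricNr, metric0l, metric0r).

Lemma metricity V Y Z u : V u (fun u => g (Y u) (Z u)) =
  g (nab V Y u) (Z u) + g (Y u) (nab V Z u).
Proof.
case: CD => /(_ V Y Z u) + _ _; rewrite !fibre_metricE => <-.
by congr (V u _); apply/funext => q; rewrite fibre_metricE.
Qed.

Lemma cartan_tensor_swap X Y Z u : g (T X Y u) (Z u) = g (T X Z u) (Y u).
Proof.
rewrite -!fibre_metricE !cartan_tensor_torsion; by case: CD => _ _; exact.
Qed.

Lemma rho_bracket_hmap X Y : rho_vf (bracket (b X) (b Y)) = nab (b X) Y - nab (b Y) X.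
Proof.
case: CD => _ /(_ X Y) + _; rewrite /h_torsion /torsion !hmap_rho => /eqP.
by rewrite subr_eq0 => /eqP.
Qed.

(** The Hessian formula for [Y = eta], with [vder X eta = X] and Euler's identity. *)
Lemma metric_eta X u : 2 * g (X u) (eta u) = gamma_vf X u L2.
Proof.
rewrite (fmetric_hessian Ls) vder_eta (_ : (gamma_vf eta ^~ L2) = fun u => L2 u + L2 u).
  by rewrite tangent_add ?addrK.
by apply/funext => q; rewrite energy_euler mulr2n mulrDl !mul1r.
Qed.

Lemma metric_eta_eta u : g (eta u) (eta u) = L u ^+ 2.
Proof.
have two0 : (2 : R) != 0 by rewrite pnatr_eq0.
by apply: (mulfI two0); rewrite metric_eta energy_euler.
Qed.

(** [2 g (T (X, Y), Z)] is the vertical derivative of the metric: metricity makes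
    the sum of two torsion terms appear, and they are equal. *)
Lemma gamma_metric X Y Z u : gamma_vf X u (fun u => g (Y u) (Z u)) =
  g (vder X Y u) (Z u) + g (Y u) (vder X Z u) + 2 * g (T X Y u) (Z u).
Proof.
rewrite metricity !cov_gamma !metricE [g (Y u) (T _ _ u)]metricC (cartan_tensor_swap X Z).
real_atoms; ring.
Qed.

(** Lowering an index turns [T] into the third vertical derivative of the energy, and
    vertical derivatives commute. *)
Lemma cartan_tensor_sym X Y : T X Y = T Y X.
Proof.
apply: fmetric_inj => Z u.
have four0 : (4 : R) != 0 by rewrite pnatr_eq0.
apply: (mulfI four0).
have key A B : 4 * g (T A B u) (Z u) =
    gamma_vf A u (gamma_vf B ^~ (gamma_vf Z ^~ L2)) -
    gamma_vf A u (gamma_vf (vder B Z) ^~ L2) -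
    gamma_vf (vder A B) u (gamma_vf Z ^~ L2) + gamma_vf (vder (vder A B) Z) u L2 -
    gamma_vf B u (gamma_vf (vder A Z) ^~ L2) + gamma_vf (vder B (vder A Z)) u L2.
  have E := gamma_metric A B Z u.
  have : gamma_vf A u (fun u => 2 * g (B u) (Z u)) =
      2 * gamma_vf A u (fun u => g (B u) (Z u)).
    rewrite tangent_mul ?tangent_cst ?mul0r ?add0r//; first exact: smooth_germ_cst.
    exact: smooth_fmetric.
  rewrite (_ : (fun u => 2 * _) =
      fun u => gamma_vf B u (gamma_vf Z ^~ L2) - gamma_vf (vder B Z) u L2).
    rewrite tangent_sub => [E2||]; last 2 first.
    - by do 2! apply: smooth_vf_germ.
    - by apply: smooth_vf_germ.
    have E3 := fmetric_hessian Ls (vder A B) Z u.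
    have E4 := fmetric_hessian Ls B (vder A Z) u.
    move: E E2 E3 E4; real_atoms; lra.
  by apply/funext => q; rewrite -(fmetric_hessian Ls).
have B1 : bracket (gamma_vf X) (gamma_vf Y) u (gamma_vf Z ^~ L2) =
    gamma_vf (vder X Y - vder Y X) u (gamma_vf Z ^~ L2) by rewrite bracket_gamma.
have B2 : gamma_vf (vder X (vder Y Z) - vder Y (vder X Z)) u L2 =
    gamma_vf (vder (vder X Y - vder Y X) Z) u L2 by rewrite vder_flat.
rewrite bracketE in B1; last by apply: smooth_vf_germ.
rewrite gamma_vfD gamma_vfN vfD vfN tvalD tvalN in B1.
rewrite vderDl vderNl !gamma_vfD !gamma_vfN !vfD !vfN !tvalD !tvalN in B2.
rewrite !key; move: B1 B2; real_atoms; lra.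
Qed.

(** [2 g (Z, eta)] is the vertical derivative of the energy along [Z]; differentiating
    it once more gives the Hessian, which leaves no room for a torsion term. *)
Lemma cartan_tensor_eta X : T X eta = 0.
Proof.
apply: fmetric_inj => Z u; rewrite metric0l cartan_tensor_swap.
have E := gamma_metric X Z eta u; rewrite vder_eta in E.
have two0 : (2 : R) != 0 by rewrite pnatr_eq0.
have : gamma_vf X u (fun u => 2 * g (Z u) (eta u)) =
    2 * gamma_vf X u (fun u => g (Z u) (eta u)).
  rewrite tangent_mul ?tangent_cst ?mul0r ?add0r//; first exact: smooth_germ_cst.
  exact: smooth_fmetric.
rewrite (_ : (fun u => 2 * _) = (fun q : TM => gamma_vf Z q L2)); last first.
  by apply/funext => q; exact: metric_eta.
have E3 := fmetric_hessian Ls X Z u; have E4 := metric_eta (vder X Z) u.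
rewrite E (metricC Z X); move: E3 E4; real_atoms; lra.
Qed.

Lemma metric_cartan_eta X Y u : g (T X Y u) (eta u) = 0.
Proof. by rewrite cartan_tensor_swap cartan_tensor_eta metric0l. Qed.

Lemma conn_map_gamma X : K (gamma_vf X) = X.
Proof. by rewrite /conn_map cov_gamma vder_eta cartan_tensor_eta addr0. Qed.

Lemma gamma_hmap_split V : V = gamma_vf (K V) + b (rho_vf V).
Proof.
have [X E] : exists X, V - b (rho_vf V) = gamma_vf X.
  by apply: vertical_gamma; rewrite rho_vfD rho_vfN hmap_rho subrr.
have <- : X = K V.
  by rewrite -[LHS]conn_map_gamma -E conn_mapD conn_mapN hmap_ker subr0.
by rewrite -E subrK.
Qed.

(** The connection that the horizontal distribution induces by Lie brackets; it
    turns out to be the horizontal part of the Berwald connection. *)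
Definition hder X Y : pvfield M := K (bracket (b X) (gamma_vf Y)).

Lemma bracket_hmap_gamma X Y :
  bracket (b X) (gamma_vf Y) = gamma_vf (hder X Y) - b (vder Y X).
Proof.
rewrite [LHS]gamma_hmap_split; congr (_ + _).
by rewrite bracketC rho_vfN rho_bracket hmap_rho hmapN.
Qed.

Lemma hderDr X Y Z : hder X (Y + Z) = hder X Y + hder X Z.
Proof. by rewrite /hder gamma_vfD bracketDr conn_mapD. Qed.

Lemma hderNr X Y : hder X (- Y) = - hder X Y.
Proof. by rewrite /hder gamma_vfN bracketNr conn_mapN. Qed.

Lemma hderDl X Y Z : hder (X + Y) Z = hder X Z + hder Y Z.
Proof. by rewrite /hder hmapD bracketDl conn_mapD. Qed.

Lemma hderZr f (fs : smooth_fun (N := TM) f) X Y : hder X (pvf_scale fs Y) =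
  pvf_scale fs (hder X Y) + pvf_scale (fun u => smooth_vf_germ (b X) (fs u)) Y.
Proof. by rewrite /hder gamma_vfZ bracketZr conn_mapD !conn_mapZ conn_map_gamma. Qed.

(** The torsion is tensorial and vanishes on two vertical and on two horizontal
    vectors. *)
Lemma torsionE V W : torsion D V W = T (K V) (rho_vf W) - T (K W) (rho_vf V).
Proof.
have gg A B : torsion D (gamma_vf A) (gamma_vf B) = 0.
  rewrite /torsion !rho_gamma_vf !cov0r bracket_gamma rho_gamma_vf.
  by rewrite !subr0.
have hh A B : torsion D (b A) (b B) = 0 by case: CD => _ + _; exact.
rewrite {1}[V]gamma_hmap_split {1}[W]gamma_hmap_split torsionDl !torsionDr gg hh.
by rewrite (torsionC _ (b _)) add0r addr0 !cartan_tensor_torsion.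
Qed.

Lemma hv_curvature_etaE X Y : hv_curvature_eta D X Y = hder X Y - nab (b X) Y.
Proof.
rewrite /hv_curvature_eta /curvature.
have Ke V : nab V eta = K V by [].
rewrite !Ke conn_map_gamma hmap_ker cov0r addr0; exact: addrC.
Qed.

(** The term [\hat P] turns [nab] into [hder] on horizontal vectors, the term [T]
    turns it into [vder] on vertical ones.  Thus the Berwald connection depends on
    the horizontal distribution only. *)
Lemma berwaldE V Y : berwald_conn D V Y = vder (K V) Y + hder (rho_vf V) Y.
Proof.
rewrite berwald_conn.unlock /berwald -cartan_tensor_torsion hv_curvature_etaE.
rewrite {1}[V]gamma_hmap_split covDl cov_gamma.
pvf_ring.
Qed.

Lemma curvature_skew V W Y Z u :
  g (curvature nab V W Y u) (Z u) = - g (Y u) (curvature nab V W Z u).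
Proof.
have D2 (A B : vfield TM) : A u (B ^~ (fun u => g (Y u) (Z u))) =
    g (nab A (nab B Y) u) (Z u) + g (nab B Y u) (nab A Z u) +
    (g (nab A Y u) (nab B Z u) + g (Y u) (nab A (nab B Z) u)).
  have -> : (B ^~ (fun u => g (Y u) (Z u))) =
      fun q : TM => g (nab B Y q) (Z q) + g (Y q) (nab B Z q).
    by apply/funext => q; exact: metricity.
  by rewrite tangent_add ?metricity//; exact: smooth_fmetric.
have B1 := bracketE V W (@smooth_fmetric _ _ _ _ Ls Y Z u).
rewrite (D2 V W) (D2 W V) (metricity (bracket V W)) in B1.
rewrite /curvature !metricE; move: B1; real_atoms; lra.
Qed.

(** The first Bianchi identity for two horizontal vectors and a vertical one.  The
    terms that do not involve [T] cancel by the Jacobi identity for [gamma Y],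
    [b X] and [b Z]. *)
Lemma Bianchi X Y Z :
  curvature nab (b X) (gamma_vf Y) Z - curvature nab (b Z) (gamma_vf Y) X =
  nab (b Z) (T Y X) - nab (b X) (T Y Z) + T Y (nab (b X) Z - nab (b Z) X)
  + T (hder X Y) Z - T (hder Z Y) X.
Proof.
have J := congr1 (@rho_vf R n M) (Jacobi (gamma_vf Y) (b X) (b Z)).
rewrite rho_bracket (bracketC (gamma_vf Y) (b X)) (bracketC (gamma_vf Y) (b Z)) in J.
rewrite !bracket_hmap_gamma in J.
rewrite (opprB (gamma_vf _)) (opprB (gamma_vf (hder Z Y))) in J.
rewrite bracketDl bracketNl bracketDr bracketNr in J.
rewrite (bracketC (b X) (gamma_vf _)) opprK in J.
rewrite !rho_vfD rho_vfN !rho_bracket !rho_bracket_hmap hmap_rho in J.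
have JY := cov_gamma D Y (nab (b X) Z - nab (b Z) X); rewrite {}J in JY.
rewrite covDr covNr in JY.
rewrite /curvature !bracket_hmap_gamma !(covDl, covNl).
rewrite !(cov_gamma D _ X) !(cov_gamma D _ Z) !(covDr, covNr).
rewrite hmap_rho in JY.
apply: pvf_germP => u h _.
have {JY} := congr1 (fun A : pvfield M => A u h) JY.
rewrite !(pvfD, pvfN, tvalD, tvalN); real_atoms; lra.
Qed.

(** The covariant derivative of [T] along the spray [G = b eta], evaluated at
    [(Y, X)]; the term [hder eta Y] stands for [nab_G Y], to which it is equal by
    [hder_eta]. *)
Definition landsberg X Y : pvfield M :=
  nab (b eta) (T Y X) - T Y (nab (b eta) X) - T (hder eta Y) X.

(** The tensor [\hat P], by [phat_curvature]. *)
Definition phat X Y : pvfield M := hder X Y - nab (b X) Y.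

Lemma phat_curvature X Y : phat X Y = curvature nab (b X) (gamma_vf Y) eta.
Proof. by rewrite -[RHS]/(hv_curvature_eta D X Y) hv_curvature_etaE. Qed.

Lemma cov_hmap_eta X : nab (b X) eta = 0. Proof. exact: hmap_ker. Qed.

Lemma landsberg_swap X Y Z u :
  g (landsberg X Y u) (Z u) = g (landsberg Z Y u) (X u).
Proof.
have E1 := metricity (b eta) (T Y X) Z u.
have E2 := metricity (b eta) (T Y Z) X u.
have E3 : (fun u => g (T Y X u) (Z u)) = (fun u => g (T Y Z u) (X u)).
  by apply/funext => q; exact: cartan_tensor_swap.
rewrite E3 {}E2 in E1.
have S1 := cartan_tensor_swap Y (nab (b eta) X) Z u.
have S2 := cartan_tensor_swap Y (nab (b eta) Z) X u.
have S3 := cartan_tensor_swap (hder eta Y) X Z u.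
rewrite /landsberg !metricE; move: E1 S1 S2 S3; real_atoms; lra.
Qed.

(** Put [A (X, Z, W) = g (P (X, Y) Z, W)].  It is skew-symmetric in [Z] and [W], and
    the Bianchi identity gives its skew part in [X] and [Z].  So [A (X, eta, W)] is
    found like the Christoffel symbols, by a cyclic combination. *)
Lemma phatE X Y : phat X Y = landsberg X Y.
Proof.
apply: fmetric_inj => W u.
pose A (X Z W : pvfield M) := g (curvature nab (b X) (gamma_vf Y) Z u) (W u).
have skew (V Z U : pvfield M) : A V Z U = - A V U Z.
  by rewrite /A curvature_skew [in RHS]metricC.
have B1 Z U : A Z eta U - A eta Z U = g (landsberg Z Y u) (U u).
  rewrite /A -metricNl -metricDl Bianchi cartan_tensor_eta cov0r cov_hmap_eta.
  congr (g _ (U u)); rewrite sub0r cartan_tensorNr /landsberg cartan_tensor_eta.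
  by congr (pvf _ u); pvf_ring.
have g0 Z U : g (nab (b Z) (T Y U) u) (eta u) = 0.
  have := metricity (b Z) (T Y U) eta u; rewrite cov_hmap_eta metric0r addr0 => <-.
  rewrite (_ : (fun u => _) = fun=> 0) ?tangent_cst//.
  by apply/funext => q; exact: metric_cartan_eta.
(* [T] is orthogonal to [eta], and so are its horizontal derivatives. *)
have B3 : A W X eta = A X W eta.
  apply/eqP; rewrite -subr_eq0; apply/eqP.
  rewrite /A -metricNl -metricDl Bianchi !metricE !metric_cartan_eta !g0; ring.
have E1 := B1 X W; have E2 := B1 W X; rewrite -(landsberg_swap X) in E2.
have E4 := skew eta X W; have E5 := skew W X eta; have E6 := skew X W eta.
rewrite phat_curvature -/(A X eta W).
move: E1 E2 B3 E4 E5 E6; real_atoms; lra.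
Qed.

(** With [X = eta] all terms of [phatE] vanish, as [T (_, eta) = 0] and
    [nab_G eta = 0]. *)
Lemma phat_eta_l Y : phat eta Y = 0.
Proof.
rewrite phatE /landsberg !cartan_tensor_eta cov_hmap_eta cov0r.
by rewrite cartan_tensor0r !subr0.
Qed.

Lemma hder_eta Y : hder eta Y = nab (b eta) Y.
Proof. by apply/eqP; rewrite -subr_eq0; apply/eqP; exact: phat_eta_l. Qed.

Lemma phat_sym X Y : phat X Y = phat Y X.
Proof.
rewrite !phatE /landsberg !hder_eta (cartan_tensor_sym Y X) (cartan_tensor_sym Y (nab _ _)).
rewrite (cartan_tensor_sym X (nab _ _)); pvf_ring.
Qed.

Lemma phat_swap X Y Z u : g (phat X Y u) (Z u) = g (phat X Z u) (Y u).
Proof. by rewrite phat_sym phatE landsberg_swap -phatE phat_sym. Qed.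

Lemma berwald_cov V Y : berwald_conn D V Y = nab V Y + phat (rho_vf V) Y - T (K V) Y.
Proof.
by rewrite berwald_conn.unlock /berwald hv_curvature_etaE -cartan_tensor_torsion.
Qed.

Lemma berwald_torsion V W :
  rho_vf (bracket V W) = berwald_conn D V (rho_vf W) - berwald_conn D W (rho_vf V).
Proof.
have E := torsionE V W; rewrite !berwald_cov (phat_sym (rho_vf W)).
have -> : rho_vf (bracket V W) = nab V (rho_vf W) - nab W (rho_vf V) - torsion D V W.
  by rewrite /torsion; pvf_ring.
by rewrite E; pvf_ring.
Qed.

(** [nab] is metric; [phat] and [T] are totally symmetric, hence the factors 2. *)
Lemma berwald_metric V Y Z u : V u (fun u => g (Y u) (Z u)) =
  g (berwald_conn D V Y u) (Z u) + g (Y u) (berwald_conn D V Z u) -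
  2 * g (phat (rho_vf V) Y u) (Z u) + 2 * g (T (K V) Y u) (Z u).
Proof.
have E1 := phat_swap (rho_vf V) Y Z u; have E2 := cartan_tensor_swap (K V) Y Z u.
have E3 := metricC Y (phat (rho_vf V) Z) u; have E4 := metricC Y (T (K V) Z) u.
rewrite !berwald_cov metricity; move: E1 E3.
move: (phat (rho_vf V) Y) (phat (rho_vf V) Z) => P P'; rewrite !metricE.
move: E2 E4; real_atoms; lra.
Qed.

Lemma berwaldDl V W Y :
  berwald_conn D (V + W) Y = berwald_conn D V Y + berwald_conn D W Y.
Proof.
rewrite !berwaldE conn_mapD rho_vfD vderDl hderDl; pvf_ring.
Qed.

Lemma berwald0l Y : berwald_conn D 0 Y = 0.
Proof.
by rewrite -(addrK (berwald_conn D 0 Y) (berwald_conn D 0 Y)) -berwaldDl addr0 subrr.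
Qed.

Lemma berwaldNl V Y : berwald_conn D (- V) Y = - berwald_conn D V Y.
Proof. by apply/eqP; rewrite -addr_eq0 -berwaldDl addNr berwald0l. Qed.

Lemma berwaldDr V Y Z :
  berwald_conn D V (Y + Z) = berwald_conn D V Y + berwald_conn D V Z.
Proof. rewrite !berwaldE vderDr hderDr; pvf_ring. Qed.

Lemma berwald0r V : berwald_conn D V 0 = 0.
Proof.
by rewrite -(addrK (berwald_conn D V 0) (berwald_conn D V 0)) -berwaldDr addr0 subrr.
Qed.

Lemma berwaldNr V Y : berwald_conn D V (- Y) = - berwald_conn D V Y.
Proof. by apply/eqP; rewrite -addr_eq0 -berwaldDr addNr berwald0r. Qed.

Lemma berwaldZr f (fs : smooth_fun (N := TM) f) V Y : berwald_conn D V (pvf_scale fs Y) =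
  pvf_scale fs (berwald_conn D V Y) + pvf_scale (fun u => smooth_vf_germ V (fs u)) Y.
Proof.
rewrite !berwaldE vderZr hderZr; apply: pvf_germP => u h hs.
have := congr1 (fun W : vfield TM => W u f) (gamma_hmap_split V).
rewrite !(pvfD, pvfZ, vfD, tvalD, tvalZ); cbv beta => ->.
real_atoms; ring.
Qed.

Lemma berwald_gamma X Y : berwald_conn D (gamma_vf X) Y = vder X Y.
Proof.
by rewrite berwaldE conn_map_gamma rho_gamma_vf /hder hmap0 bracket0l /conn_map cov0l addr0.
Qed.

Lemma berwald_hmap X Y : berwald_conn D (b X) Y = hder X Y.
Proof. by rewrite berwaldE hmap_ker hmap_rho vder0l add0r. Qed.

Local Notation curv := (curvature (berwald_conn D)).

Lemma berwald_curvatureC V W Z : curv V W Z = - curv W V Z.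
Proof.
have E : berwald_conn D (bracket V W) Z = - berwald_conn D (bracket W V) Z.
  by rewrite bracketC berwaldNl.
by rewrite /curvature E; pvf_ring.
Qed.

Lemma berwald_curvatureDl V V' W Z : curv (V + V') W Z = curv V W Z + curv V' W Z.
Proof. by rewrite /curvature bracketDl !berwaldDl !berwaldDr; pvf_ring. Qed.

Lemma berwald_curvatureDr V W W' Z : curv V (W + W') Z = curv V W Z + curv V W' Z.
Proof.
by rewrite berwald_curvatureC berwald_curvatureDl opprD -!(berwald_curvatureC V).
Qed.

Lemma berwald_curvature_gamma X Y Z : curv (gamma_vf X) (gamma_vf Y) Z = 0.
Proof.
rewrite /curvature bracket_gamma !berwald_gamma -vder_flat; pvf_ring.
Qed.

(** This is the [K]-component of the Jacobi identity for [b X], [gamma Y] and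
    [gamma Z]. *)
Lemma berwald_curvature_hv_sym X Y Z :
  curv (b X) (gamma_vf Y) Z = curv (b X) (gamma_vf Z) Y.
Proof.
have := congr1 K (Jacobi (b X) (gamma_vf Y) (gamma_vf Z)).
rewrite (bracket_gamma Y Z) (bracket_hmap_gamma X Y) (bracket_hmap_gamma X Z).
rewrite !(bracketDl, bracketDr).
rewrite !(bracketNl, bracketNr) (bracketC (gamma_vf Y) (b _)) !bracket_gamma opprK.
rewrite !(conn_mapD, conn_mapN) !conn_map_gamma -!/(hder _ _) hderDr hderNr => E.
rewrite /curvature !bracket_hmap_gamma !(berwaldDl, berwaldNl).
rewrite !berwald_gamma !berwald_hmap; apply: pvf_germP => u h _.
have := congr1 (fun A : pvfield M => A u h) E.
rewrite !(pvfD, pvfN, tvalD, tvalN); real_atoms; lra.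
Qed.

Lemma hmap_energy X u : b X u L2 = 0.
Proof.
rewrite (_ : L2 = fun q : TM => g (eta q) (eta q)).
  by rewrite metricity cov_hmap_eta metric0l metric0r addr0.
by apply/funext => q; rewrite metric_eta_eta.
Qed.

(** The Euler-Lagrange equation of the spray [b eta].  On vertical [V] it holds for
    every field that [rho] maps to [eta], by [vder_eta]; on horizontal [V] it
    expresses that the energy is constant along horizontal vectors. *)
Lemma euler_lagrange V u :
  b eta u (gamma_vf (rho_vf V) ^~ L2) -
  gamma_vf (rho_vf (bracket (b eta) V)) u L2 = V u L2.
Proof.
have horizontal X : b eta u (gamma_vf X ^~ L2) -
    gamma_vf (rho_vf (bracket (b eta) (b X))) u L2 = b X u L2.
  have two (f : TM -> R) (fs : smooth_fun f) (W : vfield TM) :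
      W u (fun q => 2 * f q) = 2 * W u f.
    rewrite tangent_mul ?tangent_cst ?mul0r ?add0r//; exact: smooth_germ_cst.
  rewrite hmap_energy rho_bracket_hmap cov_hmap_eta subr0 -metric_eta.
  have -> : gamma_vf X ^~ L2 = fun q : TM => 2 * g (X q) (eta q).
    by apply/funext => q; rewrite metric_eta.
  rewrite two; last exact: smooth_fmetric.
  by rewrite metricity cov_hmap_eta metric0r addr0 subrr.
have := horizontal (rho_vf V).
have E : rho_vf (bracket (b eta) V) =
    rho_vf (bracket (b eta) (b (rho_vf V))) - K V.
  rewrite {1}[V]gamma_hmap_split bracketDr rho_vfD (bracketC _ (gamma_vf _)).
  by rewrite rho_vfN rho_bracket hmap_rho vder_eta addrC.
rewrite E gamma_vfD gamma_vfN.
have := congr1 (fun W : vfield TM => W u L2) (gamma_hmap_split V).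
rewrite !(vfD, vfN, tvalD, tvalN); real_atoms; lra.
Qed.

(** The spray determines the horizontal map, since [hder eta X = nab_G X], and the
    latter is [rho [G, b X]]. *)
Lemma hmap_spray X : b X =
  gamma_vf (rho_vf (bracket (b eta) (b X))) - bracket (b eta) (gamma_vf X).
Proof.
rewrite bracket_hmap_gamma vder_eta hder_eta rho_bracket_hmap cov_hmap_eta subr0.
by rewrite opprB addrC subrK.
Qed.

End Cartan.

(** * Concurrent sections *)

Section Concurrent.
Context {R : realType} {n : nat} {M : manifold R n}.
Local Notation TM := (slit_atlas M).
Implicit Types (X Y Z U : pvfield M) (V W : vfield TM) (f : TM -> R) (u : slit M).
Variables (L : slit M -> R) (D : regular_connection M) (zeta : pvfield M).
Hypotheses (LD : cartan_pair L D) (zetaP : concurrent D zeta).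

Local Notation L2 := (fun u : slit M => L u ^+ 2).
Local Notation g := (fibre_metric L _).
Local Notation b := (hmap D).
Local Notation K := (conn_map D).
Local Notation T := (cartan_tensor D).
Local Notation nab := (cov D).
Local Notation eta := (eta M).

Let Ls := energy_smooth LD.
Let metricE := (metricDl LD, metricNl LD, metricDr LD, metricNr LD, metric0l LD,
  metric0r LD).

Lemma cov_zeta V : nab V zeta = - rho_vf V.
Proof.
rewrite {1}[V](gamma_hmap_split LD) covDl (zetaP _).1 (zetaP _).2.
exact: add0r.
Qed.

(** As [nab zeta = - rho], the curvature of [zeta] is the torsion. *)
Lemma curvature_zeta X Y : curvature nab (b X) (gamma_vf Y) zeta = - T Y X.
Proof.
rewrite /curvature !cov_zeta rho_gamma_vf hmap_rho covNr cov0r covNr cov_gamma.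
by rewrite bracketC rho_vfN rho_bracket hmap_rho; pvf_ring.
Qed.

(** Skew-symmetry of the curvature gives [g (P (X, Y) zeta, zeta) = 0], that is,
    [g (T (Y, X), zeta) = 0]. *)
Lemma cartan_tensor_zeta X : T X zeta = 0.
Proof.
apply: (fmetric_inj LD) => Z u; rewrite (metric0l LD) (cartan_tensor_swap LD).
have := curvature_skew LD (b Z) (gamma_vf X) zeta zeta u.
rewrite curvature_zeta (metricNl LD) (metricNr LD) (metricC LD zeta).
real_atoms; lra.
Qed.

Lemma vder_zeta X : vder X zeta = 0.
Proof. by have := cov_gamma D X zeta; rewrite (zetaP X).2 cartan_tensor_zeta addr0. Qed.

(** In [phatE] only [T (X, nab_G zeta)] is left, and [nab_G zeta = - eta]. *)
Lemma phat_zeta X : phat D X zeta = 0.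
Proof.
rewrite (phat_sym LD) (phatE LD) /landsberg !cartan_tensor_zeta cov0r cov_zeta hmap_rho.
by rewrite cartan_tensorNr (cartan_tensor_eta LD); pvf_ring.
Qed.

Lemma hder_zeta X : hder D X zeta = - X.
Proof.
have /eqP := phat_zeta X; rewrite subr_eq0 => /eqP ->.
by rewrite cov_zeta hmap_rho.
Qed.

Lemma berwald_zeta V : berwald_conn D V zeta = - rho_vf V.
Proof. by rewrite (berwaldE LD) vder_zeta hder_zeta add0r. Qed.

Lemma berwald_scale_zeta f (fs : smooth_fun (N := TM) f) V :
  berwald_conn D V (pvf_scale fs zeta) =
  pvf_scale (fun u => smooth_vf_germ V (fs u)) zeta - pvf_scale fs (rho_vf V).
Proof.
rewrite (berwaldZr LD) berwald_zeta; apply: pvf_germP => u h _.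
rewrite !(pvfD, pvfN, pvfZ, tvalD, tvalN, tvalZ); real_atoms; ring.
Qed.

(** By symmetry this is the hv-curvature applied to a multiple of [zeta], where
    [berwald_scale_zeta] makes it explicit. *)
Lemma berwald_curvature_zeta f (fs : smooth_fun (N := TM) f) X Z :
  curvature (berwald_conn D) (b X) (gamma_vf (pvf_scale fs zeta)) Z = 0.
Proof.
rewrite (berwald_curvature_hv_sym LD) /curvature !berwald_scale_zeta.
rewrite !((berwaldDr LD), (berwaldNr LD)) !berwald_scale_zeta !(berwaldZr LD).
rewrite !hmap_rho !rho_gamma_vf (berwald_gamma LD) (berwald0r LD) bracketC rho_vfN rho_bracket.
rewrite hmap_rho -bracketC; apply: pvf_germP => u h _.
rewrite !(pvfD, pvfN, pvfZ, pvf0, tvalD, tvalN, tvalZ, tval0); cbv beta.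
rewrite bracketE; last exact: fs.
real_atoms; ring.
Qed.

Lemma cartan_tensor_scale_zeta f (fs : smooth_fun (N := TM) f) X :
  T (pvf_scale fs zeta) X = 0.
Proof.
apply: (fmetric_inj LD) => Z u; rewrite (cartan_tensor_sym LD) (cartan_tensor_swap LD).
rewrite (metricC LD) pvfZ (fmetricZl Ls) (metricC LD zeta) (cartan_tensor_swap LD).
by rewrite cartan_tensor_zeta !(metric0l LD) mulr0.
Qed.

Definition zeta_eta u : R := g (zeta u) (eta u).
Definition zeta_sq u : R := g (zeta u) (zeta u).
Definition zeta_coef u : R := (1 + zeta_sq u)^-1.

Local Notation B := zeta_eta.
Local Notation phi := zeta_coef.

Lemma smooth_zeta_eta : smooth_fun (N := TM) B.
Proof. exact: smooth_fmetric. Qed.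

Lemma derive_metric_zeta V X u : V u (fun u => g (zeta u) (X u)) =
  - g (rho_vf V u) (X u) + g (zeta u) (nab V X u).
Proof. by rewrite (metricity LD) cov_zeta (metricNl LD). Qed.

Lemma derive_zeta_eta V u : V u B = - g (rho_vf V u) (eta u) + g (zeta u) (K V u).
Proof. exact: derive_metric_zeta. Qed.

Lemma derive_zeta_sq V u : V u zeta_sq = - (2 * g (rho_vf V u) (zeta u)).
Proof.
rewrite derive_metric_zeta cov_zeta (metricNr LD) (metricC LD zeta); real_atoms; ring.
Qed.

Lemma zeta_sq_ge0 u : 0 <= zeta_sq u.
Proof.
have [z0|/eqP z0] := eqVneq (zeta u) 0; last first.
  by case: LD => -[_ _ gpos] _; apply/ltW/gpos/eqP.
by rewrite /zeta_sq z0 (fmetric0l Ls).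
Qed.

Lemma zeta_den_neq0 u : 1 + zeta_sq u != 0.
Proof. by rewrite gt_eqF// ltr_wpDr// zeta_sq_ge0. Qed.

Lemma smooth_zeta_den : smooth_fun (N := TM) (fun u => 1 + zeta_sq u).
Proof.
move=> u; apply: smooth_germD; first exact: smooth_germ_cst.
exact: smooth_fmetric.
Qed.

Lemma smooth_zeta_coef : smooth_fun (N := TM) phi.
Proof.
move=> u.
exact: (@smooth_funV _ _ TM (fun u => 1 + zeta_sq u) zeta_den_neq0 smooth_zeta_den).
Qed.

Lemma derive_zeta_coef V u :
  V u phi = 2 * phi u ^+ 2 * g (rho_vf V u) (zeta u).
Proof.
rewrite (@tangent_inv _ _ TM u (V u) (fun u => 1 + zeta_sq u) zeta_den_neq0 smooth_zeta_den).
rewrite tangent_add ?tangent_cst; [|exact: smooth_germ_cst|exact: smooth_fmetric].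
by rewrite add0r derive_zeta_sq opprK /zeta_coef exprVn; real_atoms; ring.
Qed.

(** * The energy change *)

Definition changed : slit M -> R := energy_change L zeta.
Local Notation Lt := changed.
Local Notation Lt2 := (fun u : slit M => Lt u ^+ 2).
Local Notation gt := (fibre_metric Lt _).

Lemma changed_sq u : Lt u ^+ 2 = L u ^+ 2 + B u * B u.
Proof.
rewrite /changed /energy_change sqr_sqrtr; last by rewrite addr_ge0 ?sqr_ge0.
by rewrite fibre_metricE.
Qed.

Lemma changed_smooth : smooth_fun (N := TM) Lt2.
Proof.
move=> u; rewrite (_ : Lt2 = fun u => L u ^+ 2 + B u * B u).
  apply: smooth_germD; first exact: Ls.
  by apply: smooth_germM; exact: smooth_zeta_eta.
by apply/funext => q; exact: changed_sq.
Qed.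

Lemma derive_changed V u : V u Lt2 = V u L2 + 2 * B u * V u B.
Proof.
rewrite (_ : Lt2 = fun u => L u ^+ 2 + B u * B u).
  have Bs : smooth_germ (N := TM) u B by exact: smooth_zeta_eta.
  have L2s : smooth_germ (N := TM) u L2 by exact: Ls.
  rewrite (tangent_add (V u) L2s (smooth_germM Bs Bs)) (tangent_mul _ Bs Bs).
  by real_atoms; ring.
by apply/funext => q; exact: changed_sq.
Qed.

Lemma gamma_changed X u :
  gamma_vf X u Lt2 = 2 * (g (X u) (eta u) + B u * g (zeta u) (X u)).
Proof.
rewrite derive_changed -(metric_eta LD) derive_zeta_eta rho_gamma_vf (conn_map_gamma LD).
by rewrite (metric0l LD); real_atoms; ring.
Qed.

Lemma derive_gamma_changed X V u :
  V u (gamma_vf X ^~ Lt2) = 2 * (g (nab V X u) (eta u) + g (X u) (K V u)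
    + V u B * g (zeta u) (X u)
    + B u * (- g (rho_vf V u) (X u) + g (zeta u) (nab V X u))).
Proof.
have -> : gamma_vf X ^~ Lt2 =
    fun q : TM => 2 * (g (X q) (eta q) + B q * g (zeta q) (X q)).
  by apply/funext => q; exact: gamma_changed.
have Bs : smooth_germ (N := TM) u B by exact: smooth_zeta_eta.
have s1 := @smooth_fmetric _ _ _ _ Ls X eta u.
have s2 := @smooth_fmetric _ _ _ _ Ls zeta X u.
have s3 := smooth_germM Bs s2.
rewrite tangent_mul; [|exact: smooth_germ_cst|exact: smooth_germD].
rewrite tangent_cst mul0r add0r tangent_add// (metricity LD) tangent_mul//.
by rewrite (derive_metric_zeta V X u) -/(K V); real_atoms; ring.
Qed.

(** [B] is linear in the fibres, so that the vertical Hessian of [B ^ 2] is twice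
    the square of the vertical differential [g (zeta, _)] of [B]. *)
Lemma changed_metric X Y u :
  gt (X u) (Y u) = g (X u) (Y u) + g (zeta u) (X u) * g (zeta u) (Y u).
Proof.
have two0 : (2 : R) != 0 by rewrite pnatr_eq0.
apply: (mulfI two0); rewrite (fmetric_hessian changed_smooth).
rewrite derive_gamma_changed gamma_changed derive_zeta_eta rho_gamma_vf (conn_map_gamma LD).
rewrite cov_gamma !metricE (metric_cartan_eta LD) (metricC LD zeta (T _ _)).
rewrite (cartan_tensor_swap LD) cartan_tensor_zeta !metricE.
by rewrite (metricC LD Y); real_atoms; ring.
Qed.

Lemma changed_energy : finsler_energy Lt.
Proof.
split; first exact: changed_smooth.
  move=> u; rewrite -[gamma _]/(gamma_vf eta u) gamma_changed changed_sq.
  by rewrite (metric_eta_eta LD) /zeta_eta; real_atoms; ring.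
move=> X u X0; rewrite changed_metric ltr_wpDr -?expr2 ?sqr_ge0//.
by case: LD => -[_ _ gpos] _; exact: gpos.
Qed.

Section Change.
Variable Dt : regular_connection M.
Hypothesis CDt : cartan Lt Dt.
Let LDt : cartan_pair Lt Dt := conj changed_energy CDt.
Local Notation bt := (hmap Dt).

Lemma smooth_spray_coef : smooth_fun (N := TM) (fun u => L u ^+ 2 * phi u).
Proof. by move=> u; apply: smooth_germM; [exact: Ls|exact: smooth_zeta_coef]. Qed.

(** The two sprays differ by a vertical field [gamma mu].  The Euler-Lagrange
    equation of the changed energy on [b X] reads
    [g (mu, X) = (L ^ 2 - g (zeta, mu)) g (zeta, X)]; taking [X = zeta] yields
    [g (zeta, mu)], and then [mu = phi L ^ 2 zeta]. *)
Lemma spray_change :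
  bt eta = gamma_vf (pvf_scale smooth_spray_coef zeta) + b eta.
Proof.
pose mu := K (bt eta); have btE : bt eta = gamma_vf mu + b eta.
  by rewrite {1}[bt eta](gamma_hmap_split LD) hmap_rho.
have muX X u : g (mu u) (X u) = (L u ^+ 2 - g (zeta u) (mu u)) * g (zeta u) (X u).
  have := euler_lagrange LDt (b X) u.
  rewrite hmap_rho btE bracketDl rho_vfD rho_bracket hmap_rho.
  rewrite (rho_bracket_hmap LD) cov_hmap_eta subr0 vfD tvalD !derive_gamma_changed.
  rewrite gamma_changed (derive_changed (b X)) (hmap_energy LD) !derive_zeta_eta.
  rewrite -(metric_eta_eta LD) !rho_gamma_vf !hmap_rho !(conn_map_gamma LD) !hmap_ker.
  rewrite cov_gamma !metricE (metric_cartan_eta LD) (metricC LD zeta (T _ _)).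
  rewrite (cartan_tensor_swap LD) cartan_tensor_zeta !metricE.
  rewrite (metricC LD X mu) (metricC LD eta X).
  by real_atoms => E; lra.
suff E : mu = pvf_scale smooth_spray_coef zeta by rewrite btE E.
apply: (fmetric_inj LD) => X u; rewrite muX pvfZ (fmetricZl Ls); congr (_ * _).
have s1 := muX zeta u; have d0 := zeta_den_neq0 u; rewrite (metricC LD mu) in s1.
apply: (mulIf d0); rewrite /zeta_coef divfK//; move: s1; rewrite -/(zeta_sq u).
real_atoms; lra.
Qed.

Lemma derive_gamma_zeta_coef X u : gamma_vf X u phi = 0.
Proof. by rewrite derive_zeta_coef rho_gamma_vf (metric0l LD) mulr0. Qed.

Lemma smooth_zeta_term X Y : smooth_fun (N := TM) (fun u => phi u * g (X u) (Y u)).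
Proof.
by move=> u; apply: smooth_germM; [exact: smooth_zeta_coef|exact: smooth_fmetric].
Qed.

(** [phi g (X, Y) zeta]: for [Y = eta] the change of the horizontal map, for
    arbitrary [Y] the change of the Berwald connection. *)
Definition zeta_term X Y : pvfield M := pvf_scale (smooth_zeta_term X Y) zeta.

Lemma derive_zeta_term X Y u : gamma_vf X u (fun u => phi u * g (Y u) (eta u)) =
  phi u * (g (vder X Y u) (eta u) + g (X u) (Y u)).
Proof.
rewrite tangent_mul; [|exact: smooth_zeta_coef|exact: smooth_fmetric].
rewrite derive_gamma_zeta_coef (gamma_metric LD) vder_eta.
rewrite (metric_cartan_eta LD) (metricC LD Y X).
by real_atoms; ring.
Qed.

Lemma vder_zeta_term X Y :
  vder X (zeta_term Y eta) = zeta_term (vder X Y) eta + zeta_term X Y.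
Proof.
rewrite /zeta_term vderZr vder_zeta; apply: pvf_germP => u h _.
rewrite !(pvfD, pvfZ, tvalD, tvalZ); cbv beta; rewrite derive_zeta_term tval0.
by real_atoms; ring.
Qed.

Lemma vder_spray X : vder X (pvf_scale smooth_spray_coef zeta) =
  zeta_term X eta + zeta_term X eta.
Proof.
rewrite vderZr vder_zeta; apply: pvf_germP => u h _.
rewrite !(pvfD, pvfZ, tvalD, tvalZ); cbv beta.
have Ps : smooth_germ (N := TM) u phi by exact: smooth_zeta_coef.
have L2s : smooth_germ (N := TM) u L2 by exact: Ls.
rewrite (tangent_mul _ L2s Ps) derive_gamma_zeta_coef -(metric_eta LD) tval0.
by real_atoms; ring.
Qed.

(** Let [bt X = gamma N + b X].  In [hmap_spray] for the changed metric [N] occurs on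
    both sides, with opposite signs, and one is left with [2 N = vder X mu]. *)
Lemma hmap_change X : bt X = b X + gamma_vf (zeta_term X eta).
Proof.
set mu := pvf_scale smooth_spray_coef zeta.
pose N := K (bt X); have btE : bt X = gamma_vf N + b X.
  by rewrite {1}[bt X](gamma_hmap_split LD) hmap_rho.
have muE := spray_change.
have := congr1 K (hmap_spray LDt X); rewrite -/N.
rewrite muE btE !bracketDl !bracketDr !rho_vfD !(conn_mapD, conn_mapN).
rewrite bracket_gamma rho_gamma_vf rho_bracket hmap_rho (conn_map_gamma LD).
rewrite (bracketC (b eta) (gamma_vf N)) rho_vfN rho_bracket hmap_rho vder_eta.
rewrite (rho_bracket_hmap LD) cov_hmap_eta subr0 bracket_gamma (conn_map_gamma LD).
rewrite -/(hder D eta X) (hder_eta LD) vder_spray => E.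
rewrite addrC; suff -> : N = zeta_term X eta by [].
apply: pvf_germP => u h _; have := congr1 (fun A : pvfield M => A u h) E.
rewrite !(pvfD, pvfN, pvf0, tvalD, tvalN, tval0).
real_atoms; lra.
Qed.

Lemma conn_map_change V : conn_map Dt V = K V - zeta_term (rho_vf V) eta.
Proof.
have E : V = gamma_vf (K V) + (bt (rho_vf V) - gamma_vf (zeta_term (rho_vf V) eta)).
  by rewrite hmap_change addrK -(gamma_hmap_split LD).
rewrite {1}E !conn_mapD conn_mapN !(conn_map_gamma LDt) hmap_ker.
by rewrite sub0r.
Qed.

(** In [berwaldE] the derivatives of [Y] along [gamma zeta] cancel, and from
    [vder Y (zeta_term X eta)] there remains the term in which [eta] is
    differentiated. *)
Lemma berwald_change V Y :
  berwald_conn Dt V Y = berwald_conn D V Y - zeta_term (rho_vf V) Y.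
Proof.
rewrite (berwaldE LDt) (berwaldE LD) conn_map_change vderDl vderNl /hder hmap_change.
rewrite bracketDl conn_mapD bracket_gamma (conn_map_gamma LDt) conn_map_change vder_zeta_term.
rewrite bracketC rho_vfN rho_bracket hmap_rho -bracketC.
have -> : zeta_term (- vder Y (rho_vf V)) eta = - zeta_term (vder Y (rho_vf V)) eta.
  apply: pvfieldP => u; rewrite pvfN !pvfZ; cbv beta.
  by rewrite (metricNl LD) mulrN scaleNr.
have -> : zeta_term Y (rho_vf V) = zeta_term (rho_vf V) Y.
  by apply: pvfieldP => u; rewrite !pvfZ; cbv beta; rewrite (metricC LD Y).
pvf_ring.
Qed.

Lemma berwald_zeta_term V X Y u h : berwald_conn D V (zeta_term X Y) u h =
  - (phi u * g (X u) (Y u) * rho_vf V u h) +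
  (2 * phi u ^+ 2 * g (rho_vf V u) (zeta u) * g (X u) (Y u) +
   phi u * V u (fun u => g (X u) (Y u))) * zeta u h.
Proof.
rewrite /zeta_term (berwaldZr LD) berwald_zeta !(pvfD, pvfN, pvfZ, tvalD, tvalN, tvalZ).
have Ps : smooth_germ (N := TM) u phi by exact: smooth_zeta_coef.
have gs := @smooth_fmetric _ _ _ _ Ls X Y u.
cbv beta; rewrite (tangent_mul _ Ps gs) derive_zeta_coef.
by real_atoms; ring.
Qed.

(** With [A (V, Z) = phi g (rho V, Z) zeta] the curvature changes by the alternation
    of [(D_V A) (W, Z) - A (V, A (W, Z))]; here [D_V zeta = - rho V] produces the term
    in [rho W], the derivative of [phi] and the last term combine, [phat] drops out
    by symmetry, and [T] occurs twice, once as the torsion. *)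
Lemma curvature_change V W Z u :
  curvature (berwald_conn Dt) V W Z u = curvature (berwald_conn D) V W Z u
  + (g (torsion D V W u) (Z u) / (1 + zeta_sq u)) *: zeta u
  + alt (fun V W : vfield TM =>
      (g (rho_vf V u) (Z u) / (1 + zeta_sq u)) *: rho_vf W u
      - (g (rho_vf V u) (T (K W) Z u) / (1 + zeta_sq u)) *: zeta u
      + (g (rho_vf W u) (Z u) * g (rho_vf V u) (zeta u)
           / (1 + zeta_sq u) ^+ 2) *: zeta u) V W.
Proof.
have E1 : g (rho_vf V u) (T (K W) Z u) = g (T (K W) (rho_vf V) u) (Z u).
  by rewrite (metricC LD) (cartan_tensor_swap LD).
have E2 : g (rho_vf W u) (T (K V) Z u) = g (T (K V) (rho_vf W) u) (Z u).
  by rewrite (metricC LD) (cartan_tensor_swap LD).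
rewrite (torsionE LD) !metricE /alt E1 E2 -exprVn -!/(phi u).
apply: tangentP => h hs.
rewrite /curvature !berwald_change !((berwaldDr LD), (berwaldNr LD)).
rewrite (berwald_torsion LD).
rewrite !(pvfD, pvfN, tvalD, tvalN, tvalZ) !berwald_zeta_term.
rewrite /zeta_term !pvfZ !((fmetricDl Ls), (fmetricNl Ls), (fmetricDr Ls), (fmetricNr Ls)).
rewrite !(fmetricZr Ls) !(berwald_metric LD); cbv beta.
rewrite (phat_sym LD (rho_vf W)).
real_atoms; ring.
Qed.

Lemma conn_map_hmap_change X : K (bt X) = zeta_term X eta.
Proof. by rewrite hmap_change conn_mapD hmap_ker add0r (conn_map_gamma LD). Qed.

Lemma curvature_change_v X Y Z :
  curvature (berwald_conn Dt) (gamma_vf X) (gamma_vf Y) Z = 0.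
Proof. exact: (berwald_curvature_gamma LDt). Qed.

(** Of the alternation only the term with [T] is left, since [rho] kills [gamma Y];
    it equals the torsion term, hence the factor 2. *)
Lemma curvature_change_hv X Y Z u :
  curvature (berwald_conn Dt) (bt X) (gamma_vf Y) Z u =
  curvature (berwald_conn D) (b X) (gamma_vf Y) Z u -
  (2 * (g (T Y X u) (Z u) / (1 + zeta_sq u))) *: zeta u.
Proof.
have E : g (X u) (T Y Z u) = g (T Y X u) (Z u) by rewrite (metricC LD) (cartan_tensor_swap LD).
rewrite curvature_change /alt {1}hmap_change (berwald_curvatureDl LD).
rewrite (berwald_curvature_gamma LD) addr0 (torsionE LD) !hmap_rho !rho_gamma_vf.
rewrite cartan_tensor0r sub0r (conn_map_gamma LD) !metricE E mulNr.
apply: tangentP => h _; rewrite !(tvalD, tvalN, tvalZ) !tval0.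
real_atoms; ring.
Qed.

Lemma curvature_change_h X Y Z u :
  curvature (berwald_conn Dt) (bt X) (bt Y) Z u =
  curvature (berwald_conn D) (b X) (b Y) Z u +
  alt (fun X Y : pvfield M => (g (X u) (Z u) / (1 + zeta_sq u)) *: Y u
    + (g (Y u) (Z u) * g (X u) (zeta u) / (1 + zeta_sq u) ^+ 2) *: zeta u) X Y.
Proof.
rewrite curvature_change /alt {1}(hmap_change X) {1}(hmap_change Y) (berwald_curvatureDl LD).
rewrite !(berwald_curvatureDr LD) (berwald_curvature_gamma LD).
rewrite (berwald_curvatureC LD (gamma_vf _)) !berwald_curvature_zeta.
rewrite (torsionE LD) !hmap_rho !conn_map_hmap_change !cartan_tensor_scale_zeta !metricE.
apply: tangentP => h _; rewrite !(pvfD, pvfN, pvf0, tvalD, tvalN, tvalZ) !tval0.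
real_atoms; ring.
Qed.

End Change.
End Concurrent.

(** * The curvature of the changed Berwald connection *)

Theorem theorem5p21 (R : realType) (n : nat) (M : manifold R n)
    (L : slit M -> R) (nabla nablat : regular_connection M)
    (zeta : pvfield M) :
  finsler L ->
  cartan L nabla ->
  concurrent nabla zeta ->
  cartan (energy_change L zeta) nablat ->
  let g := fun (u : slit M) (v w : tangentM (foot u)) => fmetric L v w in
  let p2 := fun u : slit M => g u (zeta u) (zeta u) in
  let T := hv_torsion nabla in
  let K := conn_map nabla in
  let rho := @rho_vf R n M in
  (forall (X Y : vfield (slit_atlas M)) (Z : pvfield M) (u : slit M),
     curvature (berwald nablat) X Y Z u =
       curvature (berwald nabla) X Y Z u
       + (g u (torsion nabla X Y u) (Z u) / (1 + p2 u)) *: zeta u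
       + alt (fun X Y : vfield (slit_atlas M) =>
                (g u (rho X u) (Z u) / (1 + p2 u)) *: rho Y u
                - (g u (rho X u) (T (K Y) Z u) / (1 + p2 u)) *: zeta u
                + (g u (rho Y u) (Z u) * g u (rho X u) (zeta u)
                     / (1 + p2 u) ^+ 2) *: zeta u) X Y)
  /\ (forall X Y Z : pvfield M,
        berwald_v nablat X Y Z = berwald_v nabla X Y Z /\
        berwald_v nabla X Y Z = 0)
  /\ (forall (X Y Z : pvfield M) (u : slit M),
        berwald_hv nablat X Y Z u =
          berwald_hv nabla X Y Z u
          - (2 * (g u (T Y X u) (Z u) / (1 + p2 u))) *: zeta u)
  /\ (forall (X Y Z : pvfield M) (u : slit M),
        berwald_h nablat X Y Z u =
          berwald_h nabla X Y Z u
          + alt (fun X Y : pvfield M =>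
                   (g u (X u) (Z u) / (1 + p2 u)) *: Y u
                   + (g u (Y u) (Z u) * g u (X u) (zeta u)
                        / (1 + p2 u) ^+ 2) *: zeta u) X Y).
Proof.
move=> /finsler_finsler_energy EL CL zetaP CLt.
have LD : cartan_pair L nabla := conj EL CL.
have bE D : berwald D = @berwald_conn R n M D by rewrite berwald_conn.unlock.
have TE : hv_torsion nabla = cartan_tensor nabla by rewrite cartan_tensor.unlock.
move=> g; have metricE : g = @fibre_metric R n M L by rewrite /g fibre_metric.unlock.
clearbody g; subst g; rewrite /berwald_v /berwald_hv /berwald_h TE !bE.
split; [|split; [|split]].
- exact: (curvature_change LD zetaP CLt).
- move=> X Y Z; rewrite (curvature_change_v LD zetaP CLt).
  by rewrite (berwald_curvature_gamma LD).
- exact: (curvature_change_hv LD zetaP CLt).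
- exact: (curvature_change_h LD zetaP CLt).
Qed.
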